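(* Under the standing assumptions in the context, assume that $d_0=d_1=:d$, that $\omega_1$ is convex, and that $c(x,\xi)=h(\xi-x)$ with a convex function $h:\mathbb R^d\to\mathbb R$ that is strongly convex on bounded sets: for all $R>0$ there is $\beta_R>0$ such that $$\langle x^*-\xi^*,x-\xi\rangle\ge\beta_R\|x-\xi\|^2\qquad\forall (x,x^* ),(\xi,\xi^* )\in\operatorname{graph}(\partial h)\text{ with }x,\xi\in B_R(0).$$ Let $\varrho>0$ be such that $\omega_1-\omega_0\subset B_\varrho(0)$ and set $\beta:=\beta_\varrho$. Let $\bar u$ be a locally optimal control of (P) whose adjoint state $p$ is continuously differentiable in $\omega_1$ and satisfies, for some constant $\kappa<\alpha\beta$, $$\langle\nabla p(\xi)-\nabla p(\zeta),\xi-\zeta\rangle\ge-\kappa\|\xi-\zeta\|^2\qquad\forall\,\xi,\zeta\in\omega_1 .$$ If $\operatorname{supp}(u^0)$ consists of countably many points, then $\operatorname{supp}(\bar u)$ consists of at most countably many points, too. Similarly, if $\operatorname{supp}(u^0)$ is a finite set with cardinality $m\in\mathbb N$, then $|\operatorname{supp}(\bar u)|\le m$.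
   Context: For a compact set $X\subset\mathbb R^n$, $\mathfrak M(X)=C(X)^*$ denotes the finite signed Borel measures on $X$ with the total variation norm; for $\mu\ge0$, $\operatorname{supp}(\mu)=\{x\in X:\mu(B_r(x))>0\ \forall r>0\}$. $r'$ denotes the conjugate exponent of $r$. $\partial h$ is the convex subdifferential; $B_R(0)$ is the open ball; $\omega_1-\omega_0=\{\xi-x:\xi\in\omega_1,x\in\omega_0\}$. ''$p$ is continuously differentiable in $\omega_1$'' means that $p|_{\omega_1}$ coincides with a $C^1$ function on an open neighborhood of $\omega_1$, whose gradient is denoted $\nabla p$. Standing assumptions. $d_0\in\mathbb N$, $d_1\in\{2,3\}$; $\Omega\subset\mathbb R^{d_1}$ is a bounded Lipschitz domain; $\omega_0\subset\mathbb R^{d_0}$ and $\omega_1\subset\overline\Omega$ are nonempty compact sets; $u^0\in\mathfrak M(\omega_0)$, $u^0\ge 0$; $c\in C(\omega_0\times\omega_1)$; $\alpha>0$. $p_\Omega>d_1$ is an exponent (provided by Theorem 0.5(a) of Jerison–Kenig 1995) such that for every $p\in(p_\Omega',p_\Omega)$ and every $f\in W^{-1,p}(\Omega)$ the equation $-\Delta y=f$ (weak Laplacian, $-\langle\Delta y,v\rangle=\int_\Omega\nabla y\cdot\nabla v\,d\lambda^{d_1}$) has a unique solution $y\in W^{1,p}_0(\Omega)$. The exponent $q$ is fixed with $q'\in(d_1,p_\Omega)$ and, if $d_1=3$, additionally $q'<6$. $J:W^{1,q}_0(\Omega)\to\mathbb R$ is continuous and Gâteaux differentiable. $E:W^{1,q'}_0(\Omega)\to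 C(\omega_1)$ is the Sobolev embedding into $C_0(\Omega)\subset C(\overline\Omega)$ followed by restriction to $\omega_1$; $\langle E^*u,v\rangle=\int_{\omega_1}v\,du$. $S:=(-\Delta)^{-1}E^*:\mathfrak M(\omega_1)\to W^{1,q}_0(\Omega)$. $\mathrm D^c_{u^0}(u):=\inf\{\int c\,d\pi:\pi\in\mathfrak M(\omega_0\times\omega_1),\ \pi\ge0,\ (P_0)_\#\pi=u^0,\ (P_1)_\#\pi=u\}$ with coordinate projections $P_0,P_1$ and $\inf\emptyset=\infty$. Problem (P): minimize $f(u)=J(Su)+\alpha\,\mathrm D^c_{u^0}(u)$ over $u\in\mathfrak M(\omega_1)$. $\bar u$ is locally optimal if $f(\bar u)<\infty$ and $f(\bar u)\le f(u)$ for all $u$ in some norm neighborhood of $\bar u$. The adjoint state associated with $\bar u$ is the unique $p\in W^{1,q'}_0(\Omega)\hookrightarrow C(\overline\Omega)$ with $-\Delta p=J'(S\bar u)$ in $W^{-1,q'}(\Omega)$. *)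

(* Defs.v *)
From HB Require Import structures.
From mathcomp Require Import all_boot all_order all_algebra.
From mathcomp Require Import all_classical all_reals all_analysis.
From mathcomp Require Import measurable_realfun lra.

Set Implicit Arguments.
Unset Strict Implicit.
Unset Printing Implicit Defensive.

Import Order.TTheory GRing.Theory Num.Theory.
Import numFieldNormedType.Exports.

Local Open Scope classical_set_scope.
Local Open Scope ring_scope.

(* The library norm on 'rV[R]_d is the sup norm (same topology); balls, inner
   products and moduli in the statement are Euclidean. *)
Section Euclidean.
Context {R : realType} {d : nat}.
Implicit Types x y : 'rV[R]_d.

Definition dot x y : R := \sum_(i < d) x 0 i * y 0 i.
Definition enorm x : R := Num.sqrt (dot x x).
Definition eball x (r : R) : set 'rV[R]_d := [set y | enorm (y - x) < r].

End Euclidean.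

Section Borel.

Definition borel_rV_display : measure_display. Proof. exact. Qed.

Context {R : realType} {n : nat}.

Let borel : set (set 'rV[R]_n) := <<s open >>.

Let borel0 : borel set0. Proof. exact: sigma_algebra0. Qed.

Let borelC A : borel A -> borel (~` A).
Proof. exact: sigma_algebraC. Qed.

Let borelU (F : (set 'rV[R]_n)^nat) :
  (forall i, borel (F i)) -> borel (\bigcup_i F i).
Proof. exact: sigma_algebra_bigcup. Qed.

HB.instance Definition _ :=
  @isMeasurable.Build borel_rV_display 'rV[R]_n borel borel0 borelC borelU.

End Borel.

Section Lebesgue.
Context {R : realType}.

Lemma open_rV_measurable n (A : set 'rV[R]_n) : open A -> measurable A.
Proof. by move=> oA; apply: sub_sigma_algebra. Qed.

Let rat_ball n (q : 'rV[rat]_n * rat) : set 'rV[R]_n :=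
  ball (map_mx ratr q.1 : 'rV[R]_n) (ratr q.2).

Lemma open_rV_bigcup_rat_ball n (U : set 'rV[R]_n) : open U ->
  U = \bigcup_q [set x | rat_ball q `<=` U /\ rat_ball q x].
Proof.
move=> oU; apply/seteqP; split => [x Ux|x [q _ [qU qx]]]; last exact: qU.
have /nbhs_ballP[e /= e0 eU] : nbhs x U by exact: open_nbhs_nbhs.
have [r /andP[r0 re]] : exists r : rat, (0 < ratr r :> R) && (ratr r < e / 2).
  by have [r] := rat_in_itvoo (divr_gt0 e0 (ltr0n R 2)); rewrite in_itv; exists r.
have hq i : exists q : rat, `|x 0 i - ratr q| < ratr r.
  have /rat_in_itvoo[q] : x 0 i - ratr r < x 0 i + ratr r :> R.
    by rewrite ltrD2l gtrN.
  rewrite in_itv/= => /andP[h1 h2]; exists q.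
  by rewrite ltr_norml; apply/andP; split; lra.
pose q : 'rV[rat]_n := \row_i sval (cid (hq i)).
have xq : ball (map_mx ratr q : 'rV[R]_n) (ratr r) x.
  split=> // i j; rewrite !mxE ord1 /ball/= distrC.
  exact: svalP (cid (hq j)).
exists (q, r) => //=; split => // y; rewrite /rat_ball/= => qy; apply: eU.
apply: (@le_ball _ _ _ (ratr r + ratr r)); first by lra.
by apply: ball_triangle qy; exact: ball_sym.
Qed.

Lemma measurable_fun_rV d (T : measurableType d) n (f : T -> 'rV[R]_n) :
  (forall i, measurable_fun setT (fun x => f x 0 i)) -> measurable_fun setT f.
Proof.
move=> mf; apply: (@measurability _ _ T 'rV[R]_n setT f open) => //.
move=> _ [U oU <-]; rewrite setTI (open_rV_bigcup_rat_ball oU).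
rewrite preimage_bigcup; apply: countable_bigcupT_measurable => // -[q r].
have [qU|nqU] := pselect (rat_ball (q, r) `<=` U); last first.
  by rewrite (_ : _ @^-1` _ = set0)// -subset0 => x [].
have [r0|r0] := leP (ratr r : R) 0.
  rewrite (_ : _ @^-1` _ = set0)// -subset0 => x [_ []].
  by rewrite ltNge r0.
rewrite (_ : _ @^-1` _ = \bigcap_(i in [set: 'I_n])
    ((fun x => f x 0 i) @^-1` ball (ratr (q 0 i) : R) (ratr r))).
  apply: fin_bigcap_measurable => // i _; rewrite -[X in measurable X]setTI.
  by apply: mf => //; apply: open_measurable; exact: ball_open.
apply/seteqP; split => x /=.
  by move=> [_ [_ qx]] i _; have := qx 0 i; rewrite !mxE.
by move=> qx; split => //; split => // i j; rewrite !mxE ord1; exact: qx.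
Qed.

Let glue n (z : 'rV[R]_n * R) : 'rV[R]_n.+1 :=
  \row_i oapp (fun j => z.1 0 j) z.2 (unlift ord0 i).

Lemma measurable_coord n (i : 'I_n) :
  measurable_fun setT (fun x : 'rV[R]_n => x 0 i).
Proof.
apply: (measurability _ (RGenOpens.measurableE R)).
move=> _ [_ [a [b ->]] <-]; rewrite setTI; apply: open_rV_measurable.
apply: open_comp => [x _|]; [exact: coord_continuous|exact: interval_open].
Qed.

Let measurable_glue n : measurable_fun setT (@glue n).
Proof.
apply: measurable_fun_rV => i; rewrite /glue.
under eq_fun do rewrite mxE; case: (unliftP ord0 i) => [j|] _ /=; last first.
  exact: measurable_snd.
exact: (measurableT_comp (measurable_coord j) measurable_fst).
Qed.

(* The product of the measure on 'rV[R]_n with one-dimensional Lebesgue measure,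
   transported along (x, t) |-> (t, x); see lebesgue_rV_box. *)
Section step.
Context n (mu : {measure set 'rV[R]_n -> \bar R}).

Definition lebesgue_step : set 'rV[R]_n.+1 -> \bar R :=
  pushforward (mu \x lebesgue_measure)%E (@glue n).

Let step0 : lebesgue_step set0 = 0%E.
Proof. by rewrite /lebesgue_step /pushforward preimage_set0 measure0. Qed.

Let step_ge0 A : (0 <= lebesgue_step A)%E.
Proof. exact: (@measure_ge0 _ _ _ (mu \x lebesgue_measure)%E). Qed.

Let step_sigma_additive : semi_sigma_additive lebesgue_step.
Proof.
move=> F mF tF mUF; apply: measure_semi_sigma_additive => //.
exact: measurable_glue.
Qed.

HB.instance Definition _ := isMeasure.Build _ _ _ lebesgue_step
  step0 step_ge0 step_sigma_additive.

End step.

Fixpoint lebesgue_rV n : {measure set 'rV[R]_n -> \bar R} :=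
  match n with
  | 0%N => dirac (0 : 'rV[R]_0)
  | m.+1 => lebesgue_step (lebesgue_rV m)
  end.

Lemma lebesgue_rV_box n (a b : 'rV[R]_n) : (forall i, a 0 i <= b 0 i) ->
  lebesgue_rV n [set x : 'rV[R]_n | forall i, a 0 i < x 0 i <= b 0 i] =
  (\prod_(i < n) (b 0 i - a 0 i))%:E.
Proof.
elim: n a b => [|n IHn] a b ab.
  by rewrite big_ord0 /= diracE mem_set// => -[].
rewrite big_ord_recl [RHS]EFinM muleC.
set a' : 'rV[R]_n := \row_i a 0 (lift ord0 i).
set b' : 'rV[R]_n := \row_i b 0 (lift ord0 i).
have mbox : measurable [set x : 'rV[R]_n | forall i, a' 0 i < x 0 i <= b' 0 i].
  rewrite (_ : mkset _ = \bigcap_(i in [set: 'I_n])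
      ((fun x : 'rV[R]_n => x 0 i) @^-1` `]a' 0 i, b' 0 i])).
    apply: fin_bigcap_measurable => // i _; rewrite -[X in measurable X]setTI.
    by apply: measurable_coord => //; exact: measurable_itv.
  apply/seteqP; split=> x /= h i => [_|].
      by rewrite /= in_itv /=; exact: h.
    by have := h i I; rewrite /= in_itv.
have boxE : @glue n @^-1` [set x : 'rV[R]_n.+1 | forall i, a 0 i < x 0 i <= b 0 i] =
    [set x : 'rV[R]_n | forall i, a' 0 i < x 0 i <= b' 0 i] `*` `]a 0 ord0, b 0 ord0].
  apply/seteqP; split => [[x t] /= h|[x t] /= [h1 h2] i].
    split=> [i|]; first by have := h (lift ord0 i); rewrite !mxE liftK.
    by have := h ord0; rewrite !mxE unlift_none /= in_itv.
  rewrite !mxE; case: (unliftP ord0 i) => [j ->|->] /=; last first.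
    by move: h2; rewrite in_itv.
  by have := h1 j; rewrite !mxE.
transitivity ((lebesgue_rV n \x lebesgue_measure)%E
  ([set x : 'rV[R]_n | forall i, a' 0 i < x 0 i <= b' 0 i] `*` `]a 0 ord0, b 0 ord0])).
  by rewrite -boxE.
rewrite product_measure1E//.
rewrite IHn => [|i]; last by rewrite !mxE.
congr (_ * _)%E.
  by congr EFin; apply: eq_bigr => i _; rewrite !mxE.
have /= -> := lebesgue_measure_itv `]a 0 ord0, b 0 ord0].
rewrite lte_fin; case: ltP => [_|ba]; first by rewrite EFinB.
by have /eqP -> : a 0 ord0 == b 0 ord0; [rewrite eq_le ab ba|rewrite subrr].
Qed.

End Lebesgue.

Section FunctionSpaces.
Context {R : realType} {d : nat}.
Local Notation T := 'rV[R]_d.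
Local Notation leb := (@lebesgue_rV R d).
Implicit Types (Omega : set T) (p : \bar R).

Definition grad (f : T -> R) (x : T) : T := \row_i 'D_(delta_mx 0 i) f x.

(* Near each boundary point, after a rotation taking the last axis to the unit
   vector e, Omega is the strict epigraph of a Lipschitz function of the
   coordinates orthogonal to e. *)
Definition lipschitz_domain Omega :=
  [/\ open Omega, bounded_set Omega, connected Omega &
   forall x, closure Omega x -> ~ Omega x ->
     exists r (e : T) (gamma : T -> R), [/\ 0 < r, enorm e = 1,
       exists L, L.-lipschitz gamma &
       forall z, eball x r z ->
         (Omega z <-> gamma (z - dot z e *: e) < dot z e)]].

Definition smooth (phi : T -> R) :=
  forall s : seq 'I_d,
    let f := foldr (fun i (g : T -> R) => 'D_(delta_mx 0 i) g) phi s in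
    continuous f /\ forall i x, derivable f x (delta_mx 0 i).

Definition test_function Omega (phi : T -> R) := smooth phi /\
  exists K, [/\ compact K, K `<=` Omega & forall x, ~ K x -> phi x = 0].

Definition in_Lp Omega p (f : T -> R) : Prop := f \_ Omega \in Lfun leb p.

Definition Lp_norm Omega p (f : T -> R) : R :=
  fine 'N[leb]_p[EFin \o (f \_ Omega)].

(* A Sobolev function is carried together with its weak gradient; all that
   follows depends only on the a.e. class of the pair on Omega. *)
Definition jet : Type := ((T -> R) * (T -> T))%type.

Definition jet_of (phi : T -> R) : jet := (phi, grad phi).

Definition weak_gradient Omega (y : T -> R) (G : T -> T) :=
  forall phi, test_function Omega phi -> forall i,
    \int[leb]_(x in Omega) (y x * grad phi x 0 i) =
    - \int[leb]_(x in Omega) (G x 0 i * phi x).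

Definition W1 Omega p : set jet := [set y : jet |
  [/\ in_Lp Omega p y.1, forall i, in_Lp Omega p (fun x => y.2 x 0 i) &
      weak_gradient Omega y.1 y.2]].

Definition W1_norm Omega p (y : jet) : R :=
  Lp_norm Omega p y.1 + \sum_(i < d) Lp_norm Omega p (fun x => y.2 x 0 i).

(* The closure of the test functions in W^{1,p}. *)
Definition W10 Omega p : set jet := [set y : jet | W1 Omega p y /\
  forall eps, 0 < eps -> exists2 phi,
    test_function Omega phi & W1_norm Omega p (y - jet_of phi) < eps].

Definition dual_W10 Omega p : set (jet -> R) := [set F |
  (forall a y z, W10 Omega p y -> W10 Omega p z ->
     F (a *: y + z) = a * F y + F z) /\
  exists C, forall y, W10 Omega p y -> `|F y| <= C * W1_norm Omega p y].

(* W^{-1,p}, the dual of W_0^{1,p'}. *)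
Definition Wm1 Omega p : set (jet -> R) :=
  dual_W10 Omega (hoelder_conjugate p).

Definition weak_solution Omega p (f : jet -> R) : set jet := [set y : jet |
  W10 Omega p y /\ forall v, W10 Omega (hoelder_conjugate p) v ->
    \int[leb]_(x in Omega) dot (y.2 x) (v.2 x) = f v].

Definition laplace_isomorphism Omega p := forall f, Wm1 Omega p f ->
  (exists y, weak_solution Omega p f y) /\
  forall y z, weak_solution Omega p f y -> weak_solution Omega p f z ->
    W1_norm Omega p (y - z) = 0.

Definition inv_laplacian Omega p (f : jet -> R) : jet :=
  xget 0 (weak_solution Omega p f).

(* E is the bounded linear embedding of W_0^{1,p} into C_0(Omega): E y is the
   continuous representative of y on the closure of Omega. *)
Definition sobolev_embedding Omega p (E : jet -> T -> R) :=
  [/\ forall a y z, W10 Omega p y -> W10 Omega p z ->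
        forall x, closure Omega x -> E (a *: y + z) x = a * E y x + E z x,
      exists C, forall y, W10 Omega p y ->
        forall x, closure Omega x -> `|E y x| <= C * W1_norm Omega p y &
      forall y, W10 Omega p y ->
        [/\ {within closure Omega, continuous (E y)},
            forall x, closure Omega x -> ~ Omega x -> E y x = 0 &
            {ae leb, forall x, Omega x -> E y x = y.1 x}]].

(* Continuity with respect to the seminorm forces J to be well defined on a.e.
   classes. *)
Definition continuous_W10 Omega p (J : jet -> R) :=
  forall y, W10 Omega p y -> forall eps, 0 < eps -> exists2 delta, 0 < delta &
    forall z, W10 Omega p z -> W1_norm Omega p (z - y) < delta ->
      `|J z - J y| < eps.

Definition gateaux_derivative Omega p (J : jet -> R) (y : jet) (F : jet -> R) :=
  dual_W10 Omega p F /\ forall h, W10 Omega p h ->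
    (fun t : R => t^-1 * (J (y + t *: h) - J y)) @ 0^' --> F h.

End FunctionSpaces.
Arguments jet : clear implicits.

Section Charges.
Context d (T : measurableType d) {R : realType}.
Implicit Types (nu : {charge set T -> \bar R}) (X : set T).

(* Measures on a subset X are represented by measures on the whole space that
   vanish off X. *)
Definition carried_by X (mu : set T -> \bar R) :=
  forall A, measurable A -> A `&` X = set0 -> mu A = 0%E.

(* The notions below do not depend on the chosen Hahn decomposition. *)
Lemma hahn nu : {PN : set T * set T | hahn_decomposition nu PN.1 PN.2}.
Proof.
by apply: cid; have [P [N PN]] := Hahn_decomposition nu; exists (P, N).
Qed.

Definition tv_norm nu : \bar R := charge_variation (svalP (hahn nu)) setT.

Definition charge_integral nu X (f : T -> R) : R :=
  \int[jordan_pos (svalP (hahn nu))]_(x in X) f x -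
  \int[jordan_neg (svalP (hahn nu))]_(x in X) f x.

End Charges.

Section ControlProblem.
Context {R : realType} {d : nat}.
Local Notation T := 'rV[R]_d.
Local Notation jet := (jet R d).
Implicit Types u : {charge set T -> \bar R}.

Definition supp (X : set T) (mu : set T -> \bar R) : set T :=
  [set x | X x /\ forall r, 0 < r -> (0 < mu (eball x r))%E].

Definition subdifferential (h : T -> R) (x : T) : set T :=
  [set s | forall z, h x + dot s (z - x) <= h z].

Definition C1_on (U : set T) (g : T -> R) := open U /\
  forall x, U x -> differentiable g x /\ {for x, continuous (grad g)}.

Definition transport_plans (omega0 omega1 : set T) (u0 u1 : set T -> \bar R) :
    set {finite_measure set (T * T)%type -> \bar R} :=
  [set pi | [/\ carried_by (omega0 `*` omega1) pi,
    forall A, measurable A -> pushforward pi fst A = u0 A &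
    forall A, measurable A -> pushforward pi snd A = u1 A]].

Definition transport_cost (omega0 omega1 : set T) (c : T * T -> R)
    (u0 u1 : set T -> \bar R) : \bar R :=
  ereal_inf [set \int[pi]_(z in omega0 `*` omega1) (c z)%:E
            | pi in transport_plans omega0 omega1 u0 u1]%E.

Definition adjoint_embedding (omega1 : set T) (E : jet -> T -> R) u : jet -> R :=
  fun v => charge_integral u omega1 (E v).

Definition control_to_state (Omega : set T) (q : \bar R) (omega1 : set T)
    (E : jet -> T -> R) u : jet :=
  inv_laplacian Omega q (adjoint_embedding omega1 E u).

Definition objective (omega0 omega1 : set T) (u0 : set T -> \bar R) (c : T * T -> R)
    (alpha : R) (J : jet -> R) (S : {charge set T -> \bar R} -> jet) u : \bar R :=
  ((J (S u))%:E + alpha%:E * transport_cost omega0 omega1 c u0 u)%E.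

Definition locally_optimal (omega1 : set T) (f : {charge set T -> \bar R} -> \bar R) u :=
  [/\ carried_by omega1 u, (f u < +oo)%E &
    exists2 delta, 0 < delta & forall v : {charge set T -> \bar R},
      carried_by omega1 v -> (tv_norm (cadd v (cscale (-1) u)) < delta%:E)%E ->
      (f u <= f v)%E].

Definition adjoint_state (Omega : set T) (q : \bar R) (J : jet -> R)
    (y p : jet) :=
  exists2 F, gateaux_derivative Omega q J y F &
    weak_solution Omega (hoelder_conjugate q) F p.

End ControlProblem.

(* Main.v *)
(* Moving [ubar] a fraction [t] towards another marginal changes [J] to first
   order by the pairing with the adjoint state [p], while the transport cost is
   convex. Hence nearly optimal plans [pi] for [ubar] nearly minimize
   [pi |-> \int (p xi + alpha * c (x, xi)) dpi] among all plans with first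
   marginal [u0]; no optimal plan needs to exist. For each [x] the function
   [p + alpha * h (. - x)] has exactly one minimizer [tau x] on [omega1], because
   the strong convexity of [h] beats the semiconvexity of [p]. If [supp u0] is
   countable, [tau] can be taken Borel without further ado, and a compactness
   argument shows that a point of [supp ubar] outside [tau (supp u0)] would cost
   every plan a fixed positive amount. Thus [supp ubar] lies in [tau (supp u0)]. *)
From HB Require Import structures.
Require Import Defs.
From mathcomp Require Import all_boot all_order all_algebra.
From mathcomp Require Import all_classical all_reals all_analysis.
From mathcomp Require Import measurable_realfun ring lra.

Set Implicit Arguments.
Unset Strict Implicit.
Unset Printing Implicit Defensive.

Import Order.TTheory GRing.Theory Num.Theory.
Import numFieldNormedType.Exports.

Local Open Scope classical_set_scope.
Local Open Scope ring_scope.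

(** Local optimality holds in the total variation norm only and [J] is merely Gateaux
    differentiable, so optimality is tested along the segment from [ubar] to a single competitor
    [nu], the image of [u0] under [tau]. On it the state is affine up to jets of norm zero, and
    small [t] stay in the given neighbourhood; convexity of the transport cost lets the resulting
    inequality reach [nu] itself, however far away.

    Why strong convexity wins: at the midpoint of two points of [omega1] at distance [D], twice the
    value of [alpha * h (. - x)] falls below the sum of the end values by at least
    [alpha * beta / 4 * D^2], whereas for [p] it exceeds that sum by at most [kappa / 4 * D^2]. Two
    distinct minimizers thus contradict [kappa < alpha * beta]. *)

Section EuclideanTheory.
Context {R : realType} {d : nat}.
Implicit Types (x y z s : 'rV[R]_d) (a : R).

Lemma dotC x y : dot x y = dot y x.
Proof. by apply: eq_bigr => i _; rewrite mulrC. Qed.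

Lemma dotDl x y z : dot (x + y) z = dot x z + dot y z.
Proof. by rewrite -big_split; apply: eq_bigr => i _; rewrite mxE mulrDl. Qed.

Lemma dotZl a x y : dot (a *: x) y = a * dot x y.
Proof. by rewrite mulr_sumr; apply: eq_bigr => i _; rewrite mxE mulrA. Qed.

Lemma dotNl x y : dot (- x) y = - dot x y.
Proof. by rewrite -scaleN1r dotZl mulN1r. Qed.

Lemma dotDr x y z : dot x (y + z) = dot x y + dot x z.
Proof. by rewrite dotC dotDl !(dotC x). Qed.

Lemma dotZr a x y : dot x (a *: y) = a * dot x y.
Proof. by rewrite dotC dotZl dotC. Qed.

Lemma enorm_sq x : enorm x ^+ 2 = dot x x.
Proof. by rewrite sqr_sqrtr// sumr_ge0// => i _; rewrite -expr2 sqr_ge0. Qed.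

Lemma dot_gt0 x : x != 0 -> 0 < dot x x.
Proof.
move=> x0; rewrite lt_neqAle sumr_ge0 ?andbT//; last first.
  by move=> i _; rewrite -expr2 sqr_ge0.
apply: contra x0; rewrite eq_sym psumr_eq0; last first.
  by move=> i _; rewrite -expr2 sqr_ge0.
move=> /allP x0; apply/eqP/rowP => i; rewrite mxE.
by have /x0 := mem_index_enum i; rewrite /= -expr2 sqrf_eq0 => /eqP.
Qed.

End EuclideanTheory.

(** * Subgradients, strong convexity and uniqueness of minimizers *)

Section Subgradient.
Context {R : realType} {d : nat}.
Local Notation T := 'rV[R]_d.
Implicit Types (h g : T -> R) (x y z s : T) (C : set T).

Lemma convex_function_comb h : convex_function [set: T] h ->
  forall (a b : R) x y, 0 <= a -> 0 <= b -> a + b = 1 ->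
  h (a *: x + b *: y) <= a * h x + b * h y.
Proof.
move=> ch a b x y a0 b0 ab.
have a1 : a <= 1 by rewrite -ab lerDl.
have := ch (Itv01 a0 a1) x y; rewrite !inE => /(_ I I).
have -> : b = 1 - a by rewrite -ab addrAC subrr add0r.
by [].
Qed.

Lemma convex_set_comb C : convex_set C ->
  forall (a b : R) x y, 0 <= a -> 0 <= b -> a + b = 1 -> C x -> C y -> C (a *: x + b *: y).
Proof.
move=> cC a b x y a0 b0 ab Cx Cy.
have a1 : a <= 1 by rewrite -ab lerDl.
have := cC x y (Itv01 a0 a1); rewrite !inE /= => /(_ Cx Cy).
have -> : b = 1 - a by rewrite -ab addrAC subrr add0r.
by [].
Qed.

(* Hahn-Banach one coordinate at a time. *)
Lemma convex_subgradient h z : convex_function [set: T] h ->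
  exists s, subdifferential h z s.
Proof.
move=> ch.
suff : forall k : nat, (k <= d)%N -> exists s, forall v : T,
    (forall i : 'I_d, (k <= i)%N -> v 0 i = 0) -> h z + dot s v <= h (z + v).
  move=> /(_ d (leqnn d))[s hs]; exists s => y.
  rewrite -{2}(subrK z y) addrC [y - z + z]addrC addrC.
  by apply: hs => i; rewrite leqNgt ltn_ord.
elim=> [_|k IHk kd].
  exists 0 => v v0; have -> : v = 0 by apply/rowP => i; rewrite mxE v0.
  rewrite addr0 (_ : dot 0 0 = 0) ?addr0// /dot big1// => i _.
  by rewrite mxE mul0r.
have [s hs] := IHk (ltnW kd).
pose ik := Ordinal kd; pose e : T := delta_mx 0 ik.
pose W := [set w : T | forall i : 'I_d, (k <= i)%N -> w 0 i = 0].
(* Backward slopes of [h] minus [s] in the new direction [e]. By [AB] each lies below every forward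
   slope, since the weights [t / (t + r)] and [r / (t + r)] cancel the two steps along [e]. Hence
   [sup A] is an admissible new coordinate of [s]. *)
pose A := [set r : R | exists t w, [/\ 0 < t, W w &
  r = (h z + dot s w - h (z + w - t *: e)) / t]].
have AB t w : 0 < t -> W w -> ubound A ((h (z + w + t *: e) - h z - dot s w) / t).
  move=> t0 Ww _ [r [w' [r0 Ww' ->]]].
  rewrite ler_pdivrMr// mulrAC ler_pdivlMr//.
  have tr0 : t + r != 0 by rewrite gt_eqF// addr_gt0.
  have := @convex_function_comb _ ch (t / (t + r)) (r / (t + r))
    (z + w' - r *: e) (z + w + t *: e).
  have tr1 : t / (t + r) + r / (t + r) = 1 by rewrite -mulrDl divff.
  have tr_ge0 : 0 <= t + r by rewrite ltW// addr_gt0.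
  move=> /(_ (divr_ge0 (ltW t0) tr_ge0) (divr_ge0 (ltW r0) tr_ge0) tr1).
  have -> : (t / (t + r)) *: (z + w' - r *: e) + (r / (t + r)) *: (z + w + t *: e) =
      z + ((t / (t + r)) *: w' + (r / (t + r)) *: w).
    apply/rowP => i; rewrite !mxE; field; exact: tr0.
  move=> hle.
  have /hs hge : W ((t / (t + r)) *: w' + (r / (t + r)) *: w).
    by move=> i ki; rewrite !mxE Ww// Ww'// !mulr0 addr0.
  have := le_trans hge hle.
  rewrite dotDr !dotZr -(ler_pM2l (addr_gt0 t0 r0)).
  rewrite (_ : (t + r) * (t / (t + r) * _ + _) =
    t * h (z + w' - r *: e) + r * h (z + w + t *: e)); last by field.
  rewrite (_ : (t + r) * (h z + _) =
    t * (h z + dot s w') + r * (h z + dot s w)); last by field.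
  lra.
have W0 : W 0 by move=> i _; rewrite mxE.
have A0 : A !=set0.
  by exists ((h z + dot s 0 - h (z + 0 - 1 *: e)) / 1), 1, 0; rewrite ltr01.
have Asup : has_sup A.
  by split => //; exists ((h (z + 0 + 1 *: e) - h z - dot s 0) / 1); apply: AB.
pose s' : T := \row_i if i == ik then sup A else s 0 i.
exists s' => v hv; pose w : T := \row_i if i == ik then 0 else v 0 i.
have Ww : W w.
  move=> i; rewrite mxE; case: eqVneq => // /eqP ne; rewrite leq_eqVlt => /orP[|/hv//].
  by move=> /eqP ki; case: ne; apply: val_inj.
have vE : v = w + v 0 ik *: e.
  apply/rowP => i; rewrite !mxE eqxx /=; case: eqVneq => [->|_].
    by rewrite add0r mulr1.
  by rewrite mulr0 addr0.
have -> : dot s' v = dot s w + sup A * v 0 ik.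
  rewrite {1}vE dotDr dotZr; congr (_ + _).
    by apply: eq_bigr => i _; rewrite !mxE; case: eqP => //; rewrite !mulr0.
  rewrite mulrC; congr (_ * _); rewrite /dot (bigD1 ik)//= !mxE !eqxx mulr1.
  by rewrite big1 ?addr0// => i /negbTE ne; rewrite !mxE ne mulr0.
move: vE; move: (v 0 ik) => t vE; rewrite {}vE.
have [t0|t0|->] := ltgtP t 0.
- have : (h z + dot s w - h (z + w - (- t) *: e)) / (- t) <= sup A.
    by apply: sup_upper_bound => //; exists (- t), w; rewrite oppr_gt0.
  rewrite scaleNr opprK ler_pdivrMr ?oppr_gt0// mulrN [z + (w + _)]addrA.
  set u := sup A * t; lra.
- have : sup A <= (h (z + w + t *: e) - h z - dot s w) / t.
    by apply: ge_sup => //; exact: AB.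
  rewrite ler_pdivlMr// [z + (w + _)]addrA; set u := sup A * t; lra.
- by rewrite mulr0 scale0r !addr0; exact: hs.
Qed.

(* If [h y - h x >= <s, y - x> + gam |y - x|^2] for all subgradients, inserting
   the midpoint improves the constant to [beta / 4 + gam / 2], whose fixed point
   is [beta / 2]. *)
Lemma strong_subgradient h C (beta : R) :
  convex_function [set: T] h -> convex_set C ->
  (forall x xs y ys, C x -> C y -> subdifferential h x xs ->
    subdifferential h y ys -> beta * enorm (x - y) ^+ 2 <= dot (xs - ys) (x - y)) ->
  forall x y s, C x -> C y -> subdifferential h x s ->
    h x + dot s (y - x) + beta / 2 * enorm (y - x) ^+ 2 <= h y.
Proof.
move=> ch cC hmono x y s Cx Cy hs.
have rec (n : nat) : forall x y s, C x -> C y -> subdifferential h x s ->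
    h x + dot s (y - x) + beta / 2 * (1 - 2^-1 ^+ n) * enorm (y - x) ^+ 2 <= h y.
  elim: n => [|n IHn] {}x {}y {}s {}Cx {}Cy {}hs.
    by rewrite expr0 subrr mulr0 mul0r addr0; exact: hs.
  (* Going from [x] to [m] and then from [m] to [y] replaces [s] by [sm] on the second half;
     monotonicity turns this exchange into the gain [beta / 4]. *)
  pose m : T := 2^-1 *: x + 2^-1 *: y.
  have Cm : C m by apply: convex_set_comb => //; rewrite -?mulr2n; lra.
  have [sm hsm] := convex_subgradient m ch.
  have := IHn _ _ _ Cx Cm hs; have := IHn _ _ _ Cm Cy hsm.
  have := hmono _ _ _ _ Cm Cx hsm hs.
  have -> : m - x = 2^-1 *: (y - x) by apply/rowP => i; rewrite !mxE; field.
  have -> : y - m = 2^-1 *: (y - x) by apply/rowP => i; rewrite !mxE; field.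
  rewrite !enorm_sq exprS; move: (y - x) (h x) (h y) (h m) (2^-1 ^+ n) => v hx hy hm q.
  rewrite !(dotDl, dotNl, dotZr, dotZl).
  move: (dot s v) (dot sm v) (dot v v) => a b D.
  have -> : beta * (2^-1 * (2^-1 * D)) = 4^-1 * (beta * D) by field.
  have -> : beta / 2 * (1 - q) * (2^-1 * (2^-1 * D)) =
    8^-1 * (beta * D) - 8^-1 * (beta * D * q) by field.
  have -> : beta / 2 * (1 - 2^-1 * q) * D =
    2^-1 * (beta * D) - 4^-1 * (beta * D * q) by field.
  move: (beta * D) => f; lra.
(* A violation by [G > 0] would give [2 ^+ n * G <= K] for every [n]. *)
rewrite leNgt; apply/negP => hlt.
set D := enorm (y - x) ^+ 2 in hlt.
pose K := beta / 2 * D; pose G := h x + dot s (y - x) + K - h y.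
have G0 : 0 < G by rewrite subr_gt0.
have [n Kn] : exists n : nat, K < n%:R * G.
  by exists (Num.truncn (K / G)).+1; rewrite -ltr_pdivrMr// truncnS_gt.
have nG : n%:R * G <= 2 ^+ n * G.
  by rewrite ler_pM2r// -natrX ler_nat ltnW// ltn_expl.
have := rec n _ _ _ Cx Cy hs; rewrite -/D exprVn => hrec.
have GK : G <= K * (2 ^+ n)^-1.
  move: hrec; rewrite /G /K; move: (2 ^+ n)^-1 (h x) (h y) (dot s _) => r hx hy u.
  by clear; lra.
move: GK; rewrite ler_pdivlMr ?exprn_gt0// mulrC => h1.
by have := lt_le_trans Kn (le_trans nG h1); rewrite ltxx.
Qed.

(** [grad] collects partial derivatives; differentiability of [g] lets it represent the derivative
    in an arbitrary direction. *)
Lemma is_derive_line g x y (t : R) :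
  differentiable g (x + t *: (y - x)) ->
  is_derive t 1 (fun t : R => g (x + t *: (y - x)))
    (dot (grad g (x + t *: (y - x))) (y - x)).
Proof.
set v := y - x; set a := x + t *: v => dg.
have E : (fun h : R => h^-1 *: (((fun t : R => g (x + t *: v)) \o shift t) (h *: (1 : R)) -
      g (x + t *: v))) = (fun h : R => h^-1 *: ((g \o shift a) (h *: v) - g a)).
  apply/funext => h /=; congr (_ *: (g _ - _)).
  by rewrite /shift /= [h *: 1]mulr1 scalerDl addrCA.
split; first by rewrite /derivable E; exact: (diff_derivable dg).
rewrite /derive E -[LHS]/('D_v g a) deriveE//.
rewrite {1}(row_sum_delta v) linear_sum; apply: eq_bigr => i _.
by rewrite linearZ /= [grad g a 0 i]mxE deriveE// mulrC.
Qed.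

(** Adding [kappa * D / 2 * t ^+ 2] along the segment makes the derivative [dk] nondecreasing. The
    mean value theorem on the two halves then compares [2 * k 2^-1] with [k 0 + k 1], to which the
    quadratic contributes [1/2 - 1/4] times [kappa * D]. *)
Lemma semiconvex_midpoint g C (kappa : R) : convex_set C ->
  (forall x, C x -> differentiable g x) ->
  (forall x y, C x -> C y -> - kappa * enorm (x - y) ^+ 2 <=
     dot (grad g x - grad g y) (x - y)) ->
  forall x y, C x -> C y ->
    2 * g (2^-1 *: x + 2^-1 *: y) <= g x + g y + kappa / 4 * enorm (y - x) ^+ 2.
Proof.
move=> cC dg hmono x y Cx Cy.
pose L (t : R) := x + t *: (y - x).
have CL (t : R) : 0 <= t -> t <= 1 -> C (L t).
  move=> t0 t1; rewrite (_ : L t = (1 - t) *: x + t *: y).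
    by apply: convex_set_comb => //; lra.
  by apply/rowP => i; rewrite !mxE; ring.
set D := enorm (y - x) ^+ 2.
pose k t := g (L t) + kappa * D / 2 * t ^+ 2.
pose dk t := dot (grad g (L t)) (y - x) + kappa * D * t.
have kd (t : R) : 0 <= t -> t <= 1 -> is_derive t 1 k (dk t).
  move=> t0 t1; rewrite /k /dk.
  have := is_derive_line (dg _ (CL _ t0 t1)) => dgt.
  apply: is_derive_eq.
  by rewrite /GRing.scale/=; field.
have kc (a b : R) : 0 <= a -> b <= 1 -> {within `[a, b], continuous k}.
  move=> a0 b1; apply: derivable_within_continuous => t.
  rewrite in_itv /= => /andP[at_ tb].
  by have [] := kd t (le_trans a0 at_) (le_trans tb b1).
have [c1] : exists2 c, c \in `]0, 2^-1[ & k 2^-1 - k 0 = dk c * (2^-1 - 0).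
  apply: MVT => [//|t|]; last by apply: kc => //; lra.
  by rewrite in_itv /= => /andP[t0 t1]; apply: kd; lra.
rewrite in_itv /= => /andP[c10 c1h] e1.
have [c2] : exists2 c, c \in `]2^-1, 1[ & k 1 - k 2^-1 = dk c * (1 - 2^-1).
  apply: MVT => [|t|]; [lra| |by apply: kc => //; lra].
  by rewrite in_itv /= => /andP[t0 t1]; apply: kd; lra.
rewrite in_itv /= => /andP[c2h c21] e2.
have hd : dk c1 <= dk c2.
  have := hmono (L c2) (L c1) (CL _ _ _) (CL _ _ _).
  have -> : L c2 - L c1 = (c2 - c1) *: (y - x).
    by apply/rowP => i; rewrite !mxE; ring.
  rewrite enorm_sq dotZr !dotZl dotZr -enorm_sq -/D dotDl dotNl /dk.
  move=> /(_ _ _ _ _) h.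
  have : (c2 - c1) * (- kappa * (c2 - c1) * D) <= (c2 - c1) *
    (dot (grad g (L c2)) (y - x) - dot (grad g (L c1)) (y - x)).
    by apply: le_trans (h _ _ _ _); lra.
  rewrite ler_pM2l; last by lra.
  lra.
move: e1 e2; rewrite /k /L scale0r addr0 scale1r [x + (y - x)]addrC subrK.
have -> : x + 2^-1 *: (y - x) = 2^-1 *: x + 2^-1 *: y.
  by apply/rowP => i; rewrite !mxE; field.
lra.
Qed.

(** The midpoint of two distinct minimizers would be strictly better. Monotonicity of subgradients
    is assumed on the translate of [C] by [- x], where the arguments of [h] lie. *)
Lemma strongly_convex_argmin_unique g h C (alpha beta kappa : R) x :
  0 < alpha -> kappa < alpha * beta ->
  convex_function [set: T] h -> convex_set C ->
  (forall y, C y -> differentiable g y) ->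
  (forall y z, C y -> C z -> - kappa * enorm (y - z) ^+ 2 <=
     dot (grad g y - grad g z) (y - z)) ->
  (forall y ys z zs, C (y + x) -> C (z + x) -> subdifferential h y ys ->
    subdifferential h z zs -> beta * enorm (y - z) ^+ 2 <= dot (ys - zs) (y - z)) ->
  forall y z, C y -> C z ->
  (forall w, C w -> g y + alpha * h (y - x) <= g w + alpha * h (w - x)) ->
  (forall w, C w -> g z + alpha * h (z - x) <= g w + alpha * h (w - x)) ->
  y = z.
Proof.
move=> alpha0 kab ch cC dg gmono hmono y z Cy Cz ymin zmin.
pose C' := [set w : T | C (w + x)].
have cC' : convex_set C'.
  move=> a b t /set_mem aC /set_mem bC; apply/mem_set.
  have := cC _ _ t (mem_set aC) (mem_set bC); rewrite inE.
  move=> abC; rewrite /C' /= -[x]scale1r -(subrKC t%:num 1) scalerDl addrACA.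
  by rewrite -!scalerDr.
pose m : T := 2^-1 *: y + 2^-1 *: z.
have Cm : C m by apply: convex_set_comb => //; clear; lra.
have C'E w : C w -> C' (w - x) by rewrite /C' /= subrK.
(* One subgradient at the midpoint serves both ends: its linear terms are opposite and cancel in the
   sum. *)
have [s hs] := convex_subgradient (m - x) ch.
have := strong_subgradient ch cC' hmono (C'E _ Cm) (C'E _ Cz) hs.
have := strong_subgradient ch cC' hmono (C'E _ Cm) (C'E _ Cy) hs.
have := semiconvex_midpoint cC dg gmono Cy Cz.
have := zmin _ Cm; have := ymin _ Cm.
have -> : z - x - (m - x) = 2^-1 *: (z - y) by apply/rowP => i; rewrite !mxE; field.
have -> : y - x - (m - x) = - 2^-1 *: (z - y) by apply/rowP => i; rewrite !mxE; field.
rewrite -/m !enorm_sq.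
have [->//|] := eqVneq y z; rewrite eq_sym -subr_eq0 => /dot_gt0.
move: (z - y) => v; rewrite !(dotZr, dotZl).
move: (dot s v) (dot v v) (h (m - x)) (h (y - x)) (h (z - x)) (g m) (g y) (g z).
move=> a D hm hy hz gm gy gz D0 h1 h2 h3 h4 h5.
have : alpha * (2 * hm + beta / 4 * D) <= alpha * (hy + hz).
  rewrite ler_pM2l//; move: h4 h5.
  rewrite (_ : beta / 2 * (- 2^-1 * (- 2^-1 * D)) = 8^-1 * (beta * D)); last by field.
  rewrite (_ : beta / 2 * (2^-1 * (2^-1 * D)) = 8^-1 * (beta * D)); last by field.
  rewrite (_ : beta / 4 * D = 4^-1 * (beta * D)); last by field.
  by clear; move: (beta * D) => e; lra.
have lt_kab : kappa * D < alpha * beta * D by rewrite ltr_pM2r.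
rewrite mulrDr (_ : alpha * (beta / 4 * D) = 4^-1 * (alpha * beta * D)); last by field.
move: h1 h2 h3 lt_kab; rewrite (_ : kappa / 4 * D = 4^-1 * (kappa * D)); last by field.
rewrite !mulrDr [alpha * (2 * hm)]mulrCA => h1 h2 h3 lt_kab h6; exfalso.
move: h1 h2 h3 lt_kab h6.
move: (alpha * beta * D) (kappa * D) (alpha * hm) (alpha * hy) (alpha * hz).
by clear; intros; lra.
Qed.

End Subgradient.

(** * Borel measurability on products *)

Section BorelProduct.
Context {R : realType}.

(* The product sigma-algebra contains the product topology: pull back along
   [(x, y) |-> row_mx x y], which is measurable coordinatewise. *)
Lemma open_prod_measurable n m (U : set ('rV[R]_n * 'rV[R]_m)) :
  open U -> measurable U.
Proof.
move=> oU; pose V := [set w : 'rV[R]_(n + m) | U (lsubmx w, rsubmx w)].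
have oV : open V.
  apply: (@open_comp _ _ (fun w : 'rV[R]_(n + m) => (lsubmx w, rsubmx w))) => // w _.
  exact: (cvg_pair (@continuous_lsubmx R 1 n m w) (@continuous_rsubmx R 1 n m w)).
have -> : U = setT `&` (fun z => row_mx z.1 z.2) @^-1` V.
  by rewrite setTI; apply/seteqP; split => -[x y] /=; rewrite /V /= row_mxKl row_mxKr.
have mrow : measurable_fun setT (fun z : 'rV[R]_n * 'rV[R]_m => row_mx z.1 z.2).
  apply: measurable_fun_rV => i; case: (split_ordP i) => j -> /=.
    under eq_fun do rewrite row_mxEl.
    exact: (measurableT_comp (measurable_coord j) measurable_fst).
  under eq_fun do rewrite row_mxEr.
  exact: (measurableT_comp (measurable_coord j) measurable_snd).
by apply: mrow => //; exact: open_rV_measurable.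
Qed.

Lemma closed_rV_measurable n (A : set 'rV[R]_n) : closed A -> measurable A.
Proof.
move=> cA; rewrite -(setCK A); apply: measurableC; apply: open_rV_measurable.
exact: closed_openC.
Qed.

Lemma compact_rV_measurable n (A : set 'rV[R]_n) : compact A -> measurable A.
Proof.
move=> cA; apply: closed_rV_measurable; exact: compact_closed.
Qed.

Lemma within_continuous_rV_measurable n (D : set 'rV[R]_n) (f : 'rV[R]_n -> R) :
  measurable D -> {within D, continuous f} -> measurable_fun D f.
Proof.
move=> mD cf; apply: (measurability _ (RGenOpens.measurableE R)).
move=> _ [_ [a [b ->]] <-].
have /open_subspaceP[V oV VE] : open (f @^-1` `]a, b[%classic : set (subspace D)).
  by move/continuousP : cf; apply; exact: interval_open.
by rewrite setIC -VE; apply: measurableI => //; exact: open_rV_measurable.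
Qed.

Lemma within_continuous_prod_measurable n m (D : set ('rV[R]_n * 'rV[R]_m)) f :
  measurable D -> {within D, continuous f} -> measurable_fun D (f : _ -> R).
Proof.
move=> mD cf; apply: (measurability _ (RGenOpens.measurableE R)).
move=> _ [_ [a [b ->]] <-].
have /open_subspaceP[V oV VE] : open (f @^-1` `]a, b[%classic : set (subspace D)).
  by move/continuousP : cf; apply; exact: interval_open.
by rewrite setIC -VE; apply: measurableI => //; exact: open_prod_measurable.
Qed.

End BorelProduct.

(** * Supports and null sets *)

Section Support.
Context {R : realType} {d : nat}.
Local Notation T := 'rV[R]_d.

Lemma eball_center (x : T) r : 0 < r -> eball x r x.
Proof.
by move=> r0; rewrite /eball /= subrr /enorm /dot big1 ?sqrtr0// => i _; rewrite mxE mul0r.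
Qed.

Lemma enorm_continuous : continuous (enorm : T -> R).
Proof.
have dot_cont : continuous (fun y : T => dot y y).
  apply: continuous_big => [|i _ y]; first exact: add_continuous.
  exact: (cvgM (@coord_continuous R 1 d 0 i y) (@coord_continuous R 1 d 0 i y)).
by move=> x; apply: continuous_comp; [exact: dot_cont|exact: sqrt_continuous].
Qed.

Lemma eball_open (x : T) r : open (eball x r).
Proof.
have cont_dist : continuous (fun y : T => enorm (y - x)).
  move=> y; apply: (@continuous_comp _ _ _ (fun y : T => y - x) enorm).
    exact: (continuousB (@cvg_id _ (nbhs y)) (@cst_continuous _ _ x y)).
  exact: enorm_continuous.
apply: (@open_comp _ _ (fun y : T => enorm (y - x)) [set s | s < r]).
  by move=> y _; exact: cont_dist.
exact: open_lt.
Qed.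

Lemma eball_measurable (x : T) r : measurable (eball x r).
Proof. by apply: open_rV_measurable; exact: eball_open. Qed.

Lemma eball_sub_ball (x : T) (e : R) : 0 < e -> eball x e `<=` ball x e.
Proof.
move=> e0 y; rewrite /eball /= => xy; split => // i j; rewrite ord1 /ball /= distrC.
apply: le_lt_trans xy; rewrite -sqrtr_sqr ler_wsqrtr//.
rewrite /dot (bigD1 j)//= !mxE -expr2 lerDl sumr_ge0// => k _.
by rewrite -expr2 sqr_ge0.
Qed.

Lemma supp_closed (X : set T) (mu : {measure set T -> \bar R}) :
  closed X -> closed (supp X mu).
Proof.
move=> cX x clx; split.
  by apply: cX => B /clx[y [[Xy _] By]]; exists y.
move=> r r0.
have /clx[y [[_ supy] yx]] : nbhs x (eball x r).
  by apply: open_nbhs_nbhs; split; [exact: eball_open|exact: eball_center].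
have /nbhs_ballP[e /= e0 eU] : nbhs y (eball x r).
  by apply: open_nbhs_nbhs; split; [exact: eball_open|exact: yx].
have /supy : 0 < e by [].
move/lt_le_trans; apply; apply: le_measure; rewrite ?inE; try exact: eball_measurable.
by apply: subset_trans eU; exact: eball_sub_ball.
Qed.

(** A point of [X] off the support has a null Euclidean ball, inside which some rational ball
    contains the point; there are only countably many rational balls. *)
Lemma supp_conegligible (X : set T) (mu : {measure set T -> \bar R}) :
  measurable X -> carried_by X mu -> mu.-negligible (~` supp X mu).
Proof.
move=> mX cmu.
pose B (q : 'rV[rat]_d * rat) : set T := ball (map_mx ratr q.1 : T) (ratr q.2).
have oB q : open (B q).
  by exact: ball_open.
pose F (n : nat) : set T := if unpickle n is Some q then
  if mu (B q) == 0%E then B q else set0 else set0.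
have : mu.-negligible (\bigcup_n F n).
  apply: negligible_bigcup => n; rewrite /F.
  case: unpickle => [q|]; last exact: negligible_set0.
  case: ifPn => [/eqP muB|_]; last exact: negligible_set0.
  by apply/negligibleP => //; exact: open_rV_measurable.
have : mu.-negligible (~` X).
  apply/negligibleP; first exact: measurableC.
  by apply: cmu; [exact: measurableC|rewrite setICl].
move=> nX nF; apply: negligibleS (negligibleU nX nF) => x /=.
have [Xx|] := pselect (X x); last by left.
rewrite /supp /= => /not_andP[//|/existsNP[r /not_implyP[r0]]].
move=> /negP; rewrite -leNgt => mu0; right.
have : eball x r x by exact: eball_center.
rewrite {1}(open_rV_bigcup_rat_ball (@eball_open x r)) => -[q _ [qU qx]].
exists (pickle q) => //; rewrite /F pickleK ifT//.
rewrite eq_le measure_ge0 andbT (le_trans _ mu0)//.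
apply: le_measure; rewrite ?inE//; last exact: eball_measurable.
exact: open_rV_measurable.
Qed.

End Support.

(** * Mixtures, pushforwards and integrals for finite measures *)

Section FiniteMeasures.
Context {R : realType} d {T : measurableType d}.
Implicit Types (mu nu : {finite_measure set T -> \bar R}) (f g : T -> R).

Definition measure_mix (a b : {nonneg R}) mu nu : set T -> \bar R :=
  measure_add (mscale a mu) (mscale b nu).

Section mix.
Variables (a b : {nonneg R}) (mu nu : {finite_measure set T -> \bar R}).

HB.instance Definition _ := Measure.on (measure_mix a b mu nu).

Lemma measure_mixE A :
  measure_mix a b mu nu A = (a%:num%:E * mu A + b%:num%:E * nu A)%E.
Proof. exact: measure_addE. Qed.

Let mix_fin : fin_num_fun (measure_mix a b mu nu).
Proof.
move=> A mA; rewrite measure_mixE.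
by rewrite fin_numD !fin_numM// fin_num_measure.
Qed.

HB.instance Definition _ := Measure_isFinite.Build _ _ _ (measure_mix a b mu nu) mix_fin.

End mix.

(** Such integrands are integrable for every finite measure at once, so the rules for mixtures and
    pushforwards carry no integrability condition. *)
Definition bounded_mfun f := measurable_fun setT f /\ exists M, forall x, `|f x| <= M.

Lemma bounded_mfunD f g : bounded_mfun f -> bounded_mfun g ->
  bounded_mfun (fun x => f x + g x).
Proof.
move=> [mf [M fM]] [mg [N gN]]; split; first exact: measurable_funD.
by exists (M + N) => x; rewrite (le_trans (ler_normD _ _))// lerD.
Qed.

Lemma bounded_mfunZ (a : R) f : bounded_mfun f -> bounded_mfun (fun x => a * f x).
Proof.
move=> [mf [M fM]]; split; first exact: measurable_funM.
by exists (`|a| * M) => x; rewrite normrM ler_wpM2l.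
Qed.

Lemma bounded_mfun_integrable mu f : bounded_mfun f ->
  mu.-integrable setT (EFin \o f).
Proof.
move=> [mf [M fM]]; apply: measurable_bounded_integrable => //.
  by rewrite -ge0_fin_numE// fin_num_measure.
exists M; split; first by rewrite num_real.
by move=> N MN x _; exact: le_trans (fM x) (ltW MN).
Qed.

Lemma Rintegral_mix a b mu nu f : bounded_mfun f ->
  \int[measure_mix a b mu nu]_x f x =
  a%:num * \int[mu]_x f x + b%:num * \int[nu]_x f x.
Proof.
move=> bf; have [mf _] := bf.
have scaleE (k : {nonneg R}) (m : {finite_measure set T -> \bar R}) :
    \int[mscale k m]_x f x = k%:num * \int[m]_x f x.
  have ifm := bounded_mfun_integrable m bf.
  rewrite /Rintegral integralE ge0_integral_mscale//; last first.
    by apply: measurable_funepos; exact/measurable_EFinP.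
  rewrite ge0_integral_mscale//; last first.
    by apply: measurable_funeneg; exact/measurable_EFinP.
  rewrite -muleBr//; last first.
    by rewrite fin_num_adde_defr// integrable_pos_fin_num.
  by rewrite -integralE fineM// integrable_fin_num.
rewrite -!scaleE /Rintegral [in LHS]integral_measure_add//.
- by rewrite fineD//; apply: integrable_fin_num => //; exact: bounded_mfun_integrable.
- exact: bounded_mfun_integrable.
- exact: bounded_mfun_integrable.
Qed.

Lemma Rintegral_bmD mu f g : bounded_mfun f -> bounded_mfun g ->
  \int[mu]_x (f x + g x) = \int[mu]_x f x + \int[mu]_x g x.
Proof. by move=> bf bg; rewrite RintegralD//; exact: bounded_mfun_integrable. Qed.

Lemma Rintegral_bmZ mu a f : bounded_mfun f ->
  \int[mu]_x (a * f x) = a * \int[mu]_x f x.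
Proof. by move=> bf; rewrite RintegralZl//; exact: bounded_mfun_integrable. Qed.

Lemma eq_finite_measure_Rintegral mu nu f : (forall A, measurable A -> mu A = nu A) ->
  \int[mu]_x f x = \int[nu]_x f x.
Proof.
by move=> munu; rewrite /Rintegral (eq_measure_integral nu)// => A mA _; exact: munu.
Qed.

End FiniteMeasures.

Section Pushforward.
Context {R : realType} d1 d2 {T1 : measurableType d1} {T2 : measurableType d2}.
Variables (mu : {finite_measure set T1 -> \bar R}) (F : T1 -> T2).

(** The measurability proof is an argument so that the finite measure structure can be attached to
    the term itself. *)
Definition finite_pushforward of measurable_fun setT F : set T2 -> \bar R :=
  pushforward mu F.

Variable mF : measurable_fun setT F.

Let push0 : finite_pushforward mF set0 = 0%E.
Proof. by rewrite /finite_pushforward /pushforward preimage_set0 measure0. Qed.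

Let push_ge0 A : (0 <= finite_pushforward mF A)%E.
Proof. exact: measure_ge0. Qed.

Let push_sigma_additive : semi_sigma_additive (finite_pushforward mF).
Proof.
by move=> A mA tA mUA; apply: (@measure_semi_sigma_additive _ _ _ (pushforward mu F)).
Qed.

HB.instance Definition _ := isMeasure.Build _ _ _ (finite_pushforward mF)
  push0 push_ge0 push_sigma_additive.

Let push_fin : fin_num_fun (finite_pushforward mF).
Proof.
by move=> A mA; apply: fin_num_measure; rewrite -[X in measurable X]setTI; exact: mF.
Qed.

HB.instance Definition _ :=
  Measure_isFinite.Build _ _ _ (finite_pushforward mF) push_fin.

Lemma bounded_mfun_comp (f : T2 -> R) : bounded_mfun f -> bounded_mfun (f \o F).
Proof.
by move=> [mf [M fM]]; split; [exact: measurableT_comp|exists M => x; exact: fM].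
Qed.

Lemma Rintegral_finite_pushforward (f : T2 -> R) : bounded_mfun f ->
  \int[finite_pushforward mF]_x f x = \int[mu]_x f (F x).
Proof.
move=> bf; have [mf _] := bf; rewrite /Rintegral; congr fine.
transitivity (\int[pushforward mu F]_x (EFin \o f) x)%E.
  by apply: eq_measure_integral.
rewrite integral_pushforward//; first exact/measurable_EFinP.
rewrite preimage_setT; exact: (bounded_mfun_integrable mu (bounded_mfun_comp bf)).
Qed.

End Pushforward.

(** * Charges given by measures, and total variation *)

Section NonnegativeCharges.
Context {R : realType} d {T : measurableType d}.
Implicit Types (nu : {charge set T -> \bar R}) (mu : {finite_measure set T -> \bar R}).

(** On the negative Hahn set a charge that agrees with a measure is both nonnegative and
    nonpositive, so its negative Jordan part vanishes whichever decomposition [hahn] picks. *)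
Lemma charge_integral_measure nu mu X (f : T -> R) : measurable X ->
  (forall A, measurable A -> nu A = mu A) ->
  charge_integral nu X f = \int[mu]_(x in X) f x.
Proof.
move=> mX numu; rewrite /charge_integral; move: (svalP (hahn nu)); move: (sval _) => -[P N] /= PN.
have [_ [mN negN] _ _] := PN.
have neg0 A : measurable A -> jordan_neg PN A = 0%E.
  move=> mA; apply/eqP; rewrite eq_le measure_ge0 andbT.
  rewrite jordan_negE cjordan_negE /crestr0 mem_set// /crestr oppe_le0 numu//.
  exact: measurableI.
have posE A : measurable A -> jordan_pos PN A = mu A.
  move=> mA; rewrite -numu// (jordan_decomp PN mA) /cadd /=.
  by rewrite /cscale /= neg0// mule0 adde0.
rewrite [X in _ - X](_ : _ = 0) ?subr0; last first.
  rewrite /Rintegral (eq_measure_integral mzero) ?integral_measure_zero//.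
  by move=> A mA _; exact: neg0.
by rewrite /Rintegral (eq_measure_integral mu)// => A mA _; exact: posE.
Qed.

(** The variation is [nu P - nu N] for a Hahn pair, and each term is at most [C]. *)
Lemma tv_norm_le nu (C : R) : (forall A, measurable A -> `|nu A| <= C%:E)%E ->
  (tv_norm nu <= (C + C)%:E)%E.
Proof.
move=> nuC; rewrite /tv_norm; move: (svalP (hahn nu)); move: (sval _) => -[P N] /= PN.
have [[mP _] [mN _] _ _] := PN.
rewrite /charge_variation jordan_posE cjordan_posE jordan_negE cjordan_negE.
rewrite /crestr0 mem_set// /crestr !setTI EFinD.
apply: leeD; first exact: le_trans (lee_abs _) (nuC _ mP).
by apply: le_trans (nuC _ mN); rewrite -abseN lee_abs.
Qed.

End NonnegativeCharges.

(** * Lebesgue spaces on a bounded set *)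

Section BoundedDomain.
Context {R : realType} {d : nat}.
Local Notation T := 'rV[R]_d.
Local Notation leb := (@lebesgue_rV R d).
Variable Omega : set T.
Hypotheses (mO : measurable Omega) (bO : bounded_set Omega).

Lemma bounded_set_bound : exists2 M : R, 0 < M & forall x, Omega x -> `|x| <= M.
Proof.
have [M [_ hM]] := bO; exists (Num.max M 0 + 1).
  by rewrite ltr_wpDl// le_max lexx orbT.
by move=> x Ox; apply: (hM _ _ x Ox); rewrite ltr_pwDr// le_max lexx.
Qed.

Lemma coord_le_norm (x : T) i : `|x 0 i| <= `|x|.
Proof.
rewrite [leRHS]mx_normrE.
exact: (le_bigmax _ (fun ij : 'I_1 * 'I_d => `|x ij.1 ij.2|) (0, i)).
Qed.

Lemma lebesgue_rV_bounded : (leb Omega < +oo)%E.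
Proof.
have [M M0 hM] := bounded_set_bound.
(* The margin [1] puts every point strictly above the lower faces, which the half-open box
   excludes. *)
pose a : T := const_mx (- (M + 1)); pose b : T := const_mx (M + 1).
have ab i : a 0 i <= b 0 i by rewrite !mxE; lra.
have box := lebesgue_rV_box ab.
apply: (@le_lt_trans _ _ (leb [set x : T | forall i, a 0 i < x 0 i <= b 0 i])).
  apply: le_measure; rewrite ?inE//.
    rewrite (_ : mkset _ = \bigcap_(i in [set: 'I_d])
        ((fun x : T => x 0 i) @^-1` `]a 0 i, b 0 i])).
      apply: fin_bigcap_measurable => // i _; rewrite -[X in measurable X]setTI.
      by apply: measurable_coord => //; exact: measurable_itv.
    apply/seteqP; split=> x /= h i => [_|].
      by rewrite /= in_itv /=; exact: h.
    by have := h i I; rewrite /= in_itv.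
  move=> x Ox i; rewrite !mxE; have := le_trans (coord_le_norm x i) (hM _ Ox).
  by rewrite ler_norml => /andP[h1 h2]; apply/andP; split; lra.
by rewrite box ltry.
Qed.

Lemma continuous_bounded_on (f : T -> R) : continuous f ->
  exists M, forall x, Omega x -> `|f x| <= M.
Proof.
move=> cf; have [r r0 hr] := bounded_set_bound.
pose K := [set x : T | `|x| <= r].
have cK : compact K.
  apply: bounded_closed_compact.
    exists r; split; first exact: num_real.
    by move=> s rs x; rewrite /K /= => /le_trans; apply; exact: ltW.
  apply: (@closed_comp _ _ (fun x : T => `|x|) [set s | s <= r]); last exact: closed_le.
  by move=> x _; exact: norm_continuous.
have [M [_ hM]] : bounded_set (f @` K).
  by apply/compact_bounded/continuous_compact => //; exact: continuous_subspaceT.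
exists (M + 1) => x Ox; apply: (hM (M + 1)); first by rewrite ltrDl.
by exists x => //; exact: hr.
Qed.

Lemma bounded_in_Lp (p : R) (f : T -> R) : 1 <= p -> measurable_fun setT f ->
  (exists M, forall x, Omega x -> `|f x| <= M) -> in_Lp Omega p%:E f.
Proof.
move=> p1 mf [M fM].
have mfO : measurable_fun setT (f \_ Omega).
  by apply: (measurable_restrictT f mO).1; exact: measurable_funTS.
apply/andP; split; rewrite inE//=; rewrite /finite_norm unlock /Lnorm poweR_lty//.
apply: (@le_lt_trans _ _ (\int[leb]_x (((cst (Num.max M 0 `^ p)) \_ Omega) x)%:E)%E).
  apply: ge0_le_integral => //.
  - by move=> x _; rewrite lee_fin powR_ge0.
  - apply: (measurableT_comp (measurable_poweR _)); apply: measurableT_comp => //.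
    exact/measurable_EFinP.
  - apply/measurable_EFinP.
    exact: ((measurable_restrictT _ mO).1 (@measurable_cst _ _ _ _ _ _)).
  move=> x _; rewrite lee_fin /patch; case: ifPn => [/set_mem Ox|_]; last first.
    by rewrite normr0 powR0// gt_eqF// (lt_le_trans ltr01).
  apply: ge0_ler_powR.
  - exact: le_trans ler01 p1.
  - by rewrite nnegrE.
  - by rewrite nnegrE le_max lexx orbT.
  - by rewrite le_max fM.
rewrite (_ : (fun x => _) = ((cst (Num.max M 0 `^ p)%:E) \_ Omega)%E); last first.
  by apply/funext => x; rewrite /patch; case: ifP.
rewrite -integral_mkcond integral_cst// lte_mul_pinfty ?lee_fin ?powR_ge0//.
exact: lebesgue_rV_bounded.
Qed.

Lemma in_Lp_lin (p : R) (a : R) (f g : T -> R) : 1 <= p ->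
  in_Lp Omega p%:E f -> in_Lp Omega p%:E g -> in_Lp Omega p%:E (fun x => a * f x + g x).
Proof.
move=> p1 fp gp; rewrite /in_Lp.
have -> : (fun x => a * f x + g x) \_ Omega = a *: (f \_ Omega) + (g \_ Omega).
  apply/funext => x; rewrite -[RHS]/(a * (f \_ Omega) x + (g \_ Omega) x) /patch.
  by case: ifP => // _; rewrite mulr0 addr0.
have p1' : (1 <= p%:E)%E by [].
have [_] := Lfun_submod_closed leb p1'; exact.
Qed.

Lemma Lp_norm_lin (p : R) (a : R) (f g : T -> R) : 1 <= p ->
  in_Lp Omega p%:E f -> in_Lp Omega p%:E g ->
  Lp_norm Omega p%:E (fun x => a * f x + g x) <=
  `|a| * Lp_norm Omega p%:E f + Lp_norm Omega p%:E g.
Proof.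
move=> p1 fp gp; rewrite /Lp_norm.
have -> : (fun x => a * f x + g x) \_ Omega = a *: (f \_ Omega) + (g \_ Omega).
  apply/funext => x; rewrite -[RHS]/(a * (f \_ Omega) x + (g \_ Omega) x) /patch.
  by case: ifP => // _; rewrite mulr0 addr0.
have p1' : (1 <= p%:E)%E by [].
pose F : LfunType leb p1' := Lfun_Sub p1' fp.
pose G : LfunType leb p1' := Lfun_Sub p1' gp.
have normZ : fine 'N[leb]_p%:E[EFin \o (a \*: F)] =
    `|a| * fine 'N[leb]_p%:E[EFin \o F].
  by rewrite LnormZ -[X in (_ * X)%E]finite_norm_fine.
by apply: le_trans (ler_LnormD (a *: F) G) _; rewrite lerD2r -normZ.
Qed.

(** Hoelder's inequality for the extensions by zero; it licenses splitting the integrals in weak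
    formulations. *)
Lemma in_Lp_mul (a b : R) (f g : T -> R) : 0 < a -> 0 < b -> a^-1 + b^-1 = 1 ->
  in_Lp Omega a%:E f -> in_Lp Omega b%:E g ->
  leb.-integrable Omega (EFin \o (fun x => f x * g x)).
Proof.
move=> a0 b0 ab /andP[/set_mem mf /set_mem nf] /andP[/set_mem mg /set_mem ng].
suff : leb.-integrable setT (EFin \o ((f \_ Omega) \* (g \_ Omega))).
  move=> h; rewrite integrable_mkcond//; apply: eq_integrable h => // x _.
  by rewrite /= /patch; case: ifP => //; rewrite mulr0.
apply/Lfun1_integrable/andP; split; first by rewrite inE; exact: measurable_funM.
rewrite inE /= /finite_norm; apply: le_lt_trans (hoelder leb mf mg a0 b0 ab) _.
move: nf ng; rewrite /= /finite_norm => nf ng.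
by rewrite lte_mul_pinfty ?Lnorm_ge0 ?ge0_fin_numE ?Lnorm_ge0.
Qed.

End BoundedDomain.

(** * Linear structure of Sobolev jets *)

Section Jets.
Context {R : realType} {d : nat}.
Local Notation T := 'rV[R]_d.
Local Notation leb := (@lebesgue_rV R d).
Local Notation jet := (jet R d).
Implicit Types (y z : jet) (phi psi : T -> R).

Local Notation partials s phi :=
  (foldr (fun i (g : T -> R) => 'D_(delta_mx 0 i) g) phi s).

Lemma partials_lin (a : R) phi psi (s : seq 'I_d) : smooth phi -> smooth psi ->
  partials s (a *: phi + psi) = a *: partials s phi + partials s psi.
Proof.
move=> sphi spsi; elim: s => //= i s ->; apply/funext => x.
have [_ dphi] := sphi s; have [_ dpsi] := spsi s.
rewrite deriveD; [|by apply: derivableZ; exact: dphi|exact: dpsi].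
by rewrite deriveZ//; exact: dphi.
Qed.

Lemma smooth_lin (a : R) phi psi : smooth phi -> smooth psi -> smooth (a *: phi + psi).
Proof.
move=> sphi spsi s /=; rewrite partials_lin//.
have [cphi dphi] := sphi s; have [cpsi dpsi] := spsi s; split => [x|i x].
  exact: (continuousD (continuousZl_tmp (k := a) (cphi x)) (cpsi x)).
by apply: derivableD; [apply: derivableZ; exact: dphi|exact: dpsi].
Qed.

Lemma test_function_lin Omega (a : R) phi psi :
  test_function Omega phi -> test_function Omega psi ->
  test_function Omega (a *: phi + psi).
Proof.
move=> [sphi [K [cK KO K0]]] [spsi [L [cL LO L0]]]; split; first exact: smooth_lin.
exists (K `|` L); split; first exact: compactU.
  by move=> x [/KO|/LO].
move=> x /not_orP[nK nL].
by rewrite -[LHS]/(a * phi x + psi x) K0// L0// mulr0 addr0.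
Qed.

Lemma jet_of_lin (a : R) phi psi : smooth phi -> smooth psi ->
  jet_of (a *: phi + psi) = a *: jet_of phi + jet_of psi.
Proof.
move=> sphi spsi; congr pair; apply/funext => x; apply/rowP => i.
have /(congr1 (@^~ x)) /= := partials_lin a [:: i] sphi spsi.
by rewrite -[in RHS]/((a *: grad phi x + grad psi x) 0 i) !mxE => ->.
Qed.

Variable Omega : set T.
Hypotheses (mO : measurable Omega) (bO : bounded_set Omega).

(** The integrability half of [W1], which is what the triangle inequality for [W1_norm] requires;
    differences [y - jet_of phi] are estimated in it without integrating [phi] by parts. *)
Definition Lp_jet (p : \bar R) y :=
  in_Lp Omega p y.1 /\ forall i, in_Lp Omega p (fun x => y.2 x 0 i).

Lemma jet_lin2E (a : R) y z i :
  (fun x => (a *: y + z).2 x 0 i) = (fun x => a * y.2 x 0 i + z.2 x 0 i).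
Proof. by apply/funext => x; rewrite -[LHS]/((a *: y.2 x + z.2 x) 0 i) !mxE. Qed.

Lemma Lp_jet_lin (p a : R) y z : 1 <= p -> Lp_jet p%:E y -> Lp_jet p%:E z ->
  Lp_jet p%:E (a *: y + z).
Proof.
move=> p1 [y1 y2] [z1 z2]; split; first exact: (in_Lp_lin a p1 y1 z1).
by move=> i; rewrite jet_lin2E; exact: in_Lp_lin.
Qed.

Lemma W1_norm_ge0 (p : \bar R) y : 0 <= W1_norm Omega p y.
Proof.
rewrite /W1_norm addr_ge0//; first by apply: fine_ge0; exact: Lnorm_ge0.
by apply: sumr_ge0 => i _; apply: fine_ge0; exact: Lnorm_ge0.
Qed.

Lemma W1_norm_lin (p a : R) y z : 1 <= p -> Lp_jet p%:E y -> Lp_jet p%:E z ->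
  W1_norm Omega p%:E (a *: y + z) <= `|a| * W1_norm Omega p%:E y + W1_norm Omega p%:E z.
Proof.
move=> p1 [y1 y2] [z1 z2]; rewrite /W1_norm mulrDr addrACA lerD//.
  exact: (Lp_norm_lin a p1 y1 z1).
rewrite mulr_sumr -big_split /=; apply: ler_sum => i _.
by rewrite jet_lin2E; exact: Lp_norm_lin.
Qed.

Lemma continuous_rV_measurable (f : T -> R) : continuous f -> measurable_fun setT f.
Proof.
move=> cf; apply: within_continuous_rV_measurable => //.
exact: continuous_subspaceT.
Qed.

Lemma continuous_in_Lp (p : R) (f : T -> R) : 1 <= p -> continuous f ->
  in_Lp Omega p%:E f.
Proof.
move=> p1 cf; apply: bounded_in_Lp => //.
  exact: continuous_rV_measurable.
exact: continuous_bounded_on.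
Qed.

Lemma smooth_partial_continuous phi i : smooth phi ->
  continuous (fun x => grad phi x 0 i).
Proof.
move=> sphi; have [] := sphi [:: i].
rewrite /= (_ : (fun x => grad phi x 0 i) = 'D_(delta_mx 0 i) phi)//.
by apply/funext => x; rewrite mxE.
Qed.

Lemma smooth_Lp_jet (p : R) phi : 1 <= p -> smooth phi -> Lp_jet p%:E (jet_of phi).
Proof.
move=> p1 sphi; split.
  by apply: continuous_in_Lp => //; have [] := sphi [::].
by move=> i; apply: continuous_in_Lp => //; exact: smooth_partial_continuous.
Qed.

Variables (p q : R).
Hypotheses (p1 : 1 <= p) (q1 : 1 <= q) (pq : p^-1 + q^-1 = 1).

Let p0 : 0 < p. Proof. exact: lt_le_trans p1. Qed.
Let q0 : 0 < q. Proof. exact: lt_le_trans q1. Qed.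

(** Hoelder pairs [p] with [q], so every product in the weak gradient identity is integrable and the
    integrals split: test functions and their partials lie in the [q] space because [Omega] is
    bounded. *)
Lemma W1_lin (a : R) y z : W1 Omega p%:E y -> W1 Omega p%:E z ->
  W1 Omega p%:E (a *: y + z).
Proof.
move=> [y1 y2 wy] [z1 z2 wz].
have [yz1 yz2] := Lp_jet_lin a p1 (conj y1 y2) (conj z1 z2).
split=> // phi tphi i; have [sphi _] := tphi.
have phi1 : in_Lp Omega q%:E (fun x => grad phi x 0 i).
  by apply: continuous_in_Lp => //; exact: smooth_partial_continuous.
have phi0 : in_Lp Omega q%:E phi.
  by apply: continuous_in_Lp => //; have [] := sphi [::].
have intl f : in_Lp Omega p%:E f ->
  leb.-integrable Omega (EFin \o (fun x => f x * grad phi x 0 i)).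
  by move=> fp; exact: in_Lp_mul fp phi1.
have intr f : in_Lp Omega p%:E f ->
  leb.-integrable Omega (EFin \o (fun x => f x * phi x)).
  by move=> fp; exact: in_Lp_mul fp phi0.
have linE (f g w : T -> R) : leb.-integrable Omega (EFin \o (fun x => f x * w x)) ->
    leb.-integrable Omega (EFin \o (fun x => g x * w x)) ->
    \int[leb]_(x in Omega) ((a * f x + g x) * w x) =
    a * \int[leb]_(x in Omega) (f x * w x) + \int[leb]_(x in Omega) (g x * w x).
  move=> fw gw; rewrite -RintegralZl// -RintegralD//.
    by apply: eq_Rintegral => x _; rewrite mulrDl mulrA.
  exact: (integrableZl mO a fw).
have -> : (fun x => (a *: y + z).2 x 0 i * phi x) =
    (fun x => (a * y.2 x 0 i + z.2 x 0 i) * phi x).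
  by apply/funext => x; rewrite -[in RHS](congr1 (@^~ x) (jet_lin2E a y z i)).
rewrite (linE (fun x => y.2 x 0 i)); [|exact: intr|exact: intr].
rewrite (linE y.1 z.1); [|exact: intl|exact: intl].
by rewrite wy// wz// mulrN opprD.
Qed.

Lemma W10_lin (a : R) y z : W10 Omega p%:E y -> W10 Omega p%:E z ->
  W10 Omega p%:E (a *: y + z).
Proof.
move=> [Wy hy] [Wz hz]; split; first exact: W1_lin.
move=> eps eps0.
have a0 : 0 < `|a| + 1 by rewrite ltr_wpDl.
(* The error of [phi] gets multiplied by [|a|]; dividing by [|a| + 1] covers [a = 0] too. *)
have e1 : 0 < eps / 2 / (`|a| + 1) by rewrite !divr_gt0.
have e2 : 0 < eps / 2 by rewrite divr_gt0.
have [phi tphi hphi] := hy _ e1; have [psi tpsi hpsi] := hz _ e2.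
exists (a *: phi + psi); first exact: test_function_lin.
have [sphi _] := tphi; have [spsi _] := tpsi.
rewrite jet_of_lin// (_ : _ - _ = a *: (y - jet_of phi) + (z - jet_of psi)); last first.
  by rewrite opprD addrACA scalerBr.
have [y1 y2 _] := Wy; have [z1 z2 _] := Wz.
have subLp (u w : jet) : Lp_jet p%:E u -> Lp_jet p%:E w -> Lp_jet p%:E (u - w).
  by move=> hu hw; rewrite addrC -scaleN1r; exact: Lp_jet_lin.
have yphi : Lp_jet p%:E (y - jet_of phi) by apply: subLp; [by split|exact: smooth_Lp_jet].
have zpsi : Lp_jet p%:E (z - jet_of psi) by apply: subLp; [by split|exact: smooth_Lp_jet].
apply: le_lt_trans (W1_norm_lin a p1 yphi zpsi) _.
rewrite [ltRHS](_ : eps = (`|a| + 1) * (eps / 2 / (`|a| + 1)) + eps / 2); last first.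
  by field; rewrite gt_eqF.
apply: ler_ltD hpsi; apply: ler_pM => //; [|by rewrite lerDl|exact: ltW].
exact: W1_norm_ge0.
Qed.

Lemma dot_integrable (G H : T -> T) :
  (forall i, in_Lp Omega p%:E (fun x => G x 0 i)) ->
  (forall i, in_Lp Omega q%:E (fun x => H x 0 i)) ->
  leb.-integrable Omega (EFin \o (fun x => dot (G x) (H x))).
Proof.
move=> hG hH; rewrite (_ : EFin \o _ =
    (fun x => \sum_(i <- index_enum 'I_d | xpredT i) (EFin \o (fun x => G x 0%R i * H x 0%R i)%R) x)%E).
  by apply: integrable_sum => // i _; exact: (in_Lp_mul mO p0 q0 pq (hG i) (hH i)).
by apply/funext => x /=; rewrite sumEFin.
Qed.

Lemma weak_solution_lin (a : R) (f g : jet -> R) y z :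
  hoelder_conjugate p%:E = q%:E ->
  weak_solution Omega p%:E f y -> weak_solution Omega p%:E g z ->
  weak_solution Omega p%:E (fun v => a * f v + g v) (a *: y + z).
Proof.
move=> pE [Wy hy] [Wz hz]; split; first exact: W10_lin.
move=> v hv; rewrite -hy// -hz//.
have [[_ y2 _] _] := Wy; have [[_ z2 _] _] := Wz.
have [[_ v2 _] _] := hv; rewrite pE in v2.
rewrite -RintegralZl//; last exact: dot_integrable.
rewrite -RintegralD//; [|exact: (integrableZl mO a (dot_integrable y2 v2))|exact: dot_integrable].
apply: eq_Rintegral => x _.
by rewrite -[LHS]/(dot (a *: y.2 x + z.2 x) (v.2 x)) dotDl dotZl.
Qed.

End Jets.

(** * Extension by zero from compact sets *)

Section BoundedOnCompact.
Context {R : realType}.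

Lemma within_continuous_bounded (T : topologicalType) (K : set T) (f : T -> R) :
  compact K -> {within K, continuous f} -> exists M, forall x, `|(f \_ K) x| <= M.
Proof.
move=> cK cf.
have [M [_ hM]] : bounded_set (f @` K).
  by apply: compact_bounded; exact: continuous_compact.
exists (`|M| + 1) => x; rewrite /patch; case: ifPn => [/set_mem Kx|_].
  by apply: (hM (`|M| + 1)); [rewrite ltr_pwDr// ler_norm|exists x].
by rewrite normr0 addr_ge0.
Qed.

Lemma within_continuous_bounded_mfun n (K : set 'rV[R]_n) (f : 'rV[R]_n -> R) :
  compact K -> {within K, continuous f} -> bounded_mfun (f \_ K).
Proof.
move=> cK cf; split; last exact: within_continuous_bounded.
have mK := compact_rV_measurable cK.
apply: (measurable_restrictT f mK).1; exact: within_continuous_rV_measurable.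
Qed.

Lemma within_continuous_prod_bounded_mfun n m (K : set 'rV[R]_n) (L : set 'rV[R]_m)
    (f : 'rV[R]_n * 'rV[R]_m -> R) : compact K -> compact L ->
  {within K `*` L, continuous f} -> bounded_mfun (f \_ (K `*` L)).
Proof.
move=> cK cL cf; have cKL : compact (K `*` L) by exact: compact_setX.
split; last exact: within_continuous_bounded.
have mKL : measurable (K `*` L) by apply: measurableX; exact: compact_rV_measurable.
by apply: (measurable_restrictT f mKL).1; exact: within_continuous_prod_measurable.
Qed.

End BoundedOnCompact.

(** The conjugate exponent [b] is finite and exceeds [d >= 2], so [q = b / (b - 1) < 2 < b < pO];
    the lower bound on [q] holds because conjugation reverses order. This places [q] where the
    Laplacian is invertible. *)
Lemma conjugate_exponents (R : realType) (d : nat) (q pO : \bar R) : (2 <= d)%N ->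
  (d%:R%:E < hoelder_conjugate q < pO)%E ->
  (exists a b : R, [/\ q = a%:E, hoelder_conjugate q = b%:E, 1 <= a, 1 <= b &
     a^-1 + b^-1 = 1]) /\ (hoelder_conjugate pO < q < pO)%E.
Proof.
move=> d2; move qE: (hoelder_conjugate q) => b /andP[db bp].
have -> : q = hoelder_conjugate b by rewrite -qE hoelder_conjugateK.
have d2R : 2 <= d%:R :> R by rewrite (ler_nat _ 2).
case: b {qE} db bp => [b| |] db bp; last 2 first.
  by move: bp; rewrite ltNge leey.
  by move: db; rewrite ltNge leNye.
rewrite lte_fin in db.
have b2 : 2 < b by exact: le_lt_trans db.
have bE (x : R) : 1 < x -> hoelder_conjugate x%:E = (x / (x - 1))%:E.
  move=> x1; rewrite /hoelder_conjugate /= eqe gt_eqF ?(lt_trans ltr01)//.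
  by rewrite -EFinD inver subr_eq0 gt_eqF.
have b1 : 1 < b by apply: lt_trans b2; rewrite ltr1n.
have b10 : 0 < b - 1 by rewrite subr_gt0.
have bn0 : b != 0 by rewrite gt_eqF// (lt_trans ltr01).
split.
  exists (b / (b - 1)), b; split; rewrite ?bE// ?ltW//.
    by rewrite ltr_pdivlMr// mul1r ltrBlDr ltrDl.
  by rewrite invf_div -[X in _ + X]mul1r -mulrDl subrK divff.
rewrite (bE _ b1); apply/andP; split; last first.
  apply: lt_trans bp; rewrite lte_fin; apply: lt_trans b2.
  by rewrite ltr_pdivrMr//; lra.
case: pO bp => [P|_|//]; last by rewrite /hoelder_conjugate /= lte_fin ltr_pdivlMr// mul1r ltrBlDr ltrDl.
rewrite lte_fin => bP; have P1 := lt_trans b1 bP.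
rewrite bE// lte_fin ltr_pdivrMr ?subr_gt0// mulrAC ltr_pdivlMr//; lra.
Qed.

(** * The control-to-state map and directional derivatives of [J] *)

Section ControlToState.
Context {R : realType} {d : nat}.
Local Notation T := 'rV[R]_d.
Local Notation jet := (jet R d).
Implicit Types mu nu : {finite_measure set T -> \bar R}.
Variables (Omega omega1 : set T).
Hypotheses (mO : measurable Omega) (bO : bounded_set Omega).
Hypotheses (comega1 : compact omega1) (omega1O : omega1 `<=` closure Omega).
Variables (p q : R).
Hypotheses (p1 : 1 <= p) (q1 : 1 <= q) (pq : p^-1 + q^-1 = 1).
Hypothesis pqE : hoelder_conjugate p%:E = q%:E.
Variables (E : jet -> T -> R) (hE : sobolev_embedding Omega q%:E E).

Let momega1 : measurable omega1. Proof. exact: compact_rV_measurable. Qed.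

Lemma embedding_within_continuous v : W10 Omega q%:E v ->
  {within omega1, continuous (E v)}.
Proof.
have [_ _ cE] := hE; move=> /cE[cEv _ _].
exact: continuous_subspaceW cEv.
Qed.

Lemma embedding_bounded_mfun v : W10 Omega q%:E v -> bounded_mfun (E v \_ omega1).
Proof.
by move=> hv; apply: within_continuous_bounded_mfun => //; exact: embedding_within_continuous.
Qed.

(** This is [E^* mu] for a measure [mu]; extension by zero off [omega1] makes the integrand a
    [bounded_mfun]. *)
Definition pairing mu (v : jet) : R := \int[mu]_x (E v \_ omega1) x.

Lemma adjoint_embeddingE (u : {charge set T -> \bar R}) mu :
  (forall A, measurable A -> u A = mu A) -> adjoint_embedding omega1 E u = pairing mu.
Proof.
move=> umu; apply/funext => v; rewrite /adjoint_embedding (charge_integral_measure _ _ umu)//.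
by rewrite Rintegral_mkcond.
Qed.

Lemma pairing_mix a b mu nu v : W10 Omega q%:E v ->
  pairing (measure_mix a b mu nu) v = a%:num * pairing mu v + b%:num * pairing nu v.
Proof. by move=> hv; rewrite /pairing Rintegral_mix//; exact: embedding_bounded_mfun. Qed.

Lemma pairing_dual mu : dual_W10 Omega q%:E (pairing mu).
Proof.
have [linE [C EC] _] := hE; split=> [a y z hy hz|].
  have by_ := embedding_bounded_mfun hy; have bz := embedding_bounded_mfun hz.
  rewrite /pairing -Rintegral_bmZ// -Rintegral_bmD//; last exact: bounded_mfunZ.
  apply: eq_Rintegral => x _; rewrite /patch; case: ifPn => [/set_mem ox|_].
    by rewrite linE//; exact: omega1O.
  by rewrite mulr0 addr0.
exists (`|C| * fine (mu setT)) => v hv; have bv := embedding_bounded_mfun hv.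
have iv := bounded_mfun_integrable mu bv.
apply: le_trans (le_normr_Rintegral _ iv) _ => //.
rewrite mulrAC -(Rintegral_cst mu measurableT).
apply: le_Rintegral => //.
- exact: integrable_norm.
- exact: finite_measure_integrable_cst.
move=> x _; rewrite /patch; case: ifPn => [/set_mem ox|_]; last first.
  by rewrite normr0 mulr_ge0// W1_norm_ge0.
apply: le_trans (EC _ hv _ (omega1O ox)) _.
by rewrite ler_wpM2r ?W1_norm_ge0// ler_norm.
Qed.

Lemma eq_weak_solution (f g : jet -> R) y :
  (forall v, W10 Omega q%:E v -> f v = g v) ->
  weak_solution Omega p%:E f y -> weak_solution Omega p%:E g y.
Proof.
by move=> fg [Wy hy]; split => // v; rewrite pqE => hv; rewrite -fg// hy// pqE.
Qed.

Hypothesis hlaplace : laplace_isomorphism Omega p%:E.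

Let S := control_to_state Omega p%:E omega1 E.

Lemma control_to_stateP (u : {charge set T -> \bar R}) mu :
  (forall A, measurable A -> u A = mu A) ->
  weak_solution Omega p%:E (pairing mu) (S u).
Proof.
move=> umu; rewrite /S /control_to_state /inv_laplacian (adjoint_embeddingE umu).
have hmu : Wm1 Omega p%:E (pairing mu) by rewrite /Wm1 pqE; exact: pairing_dual.
have [hex _] := hlaplace hmu; exact: (xgetPex 0 hex).
Qed.

Variables (J : jet -> R) (hJ : continuous_W10 Omega p%:E J).

Lemma continuous_W10_eq y z : W10 Omega p%:E y -> W10 Omega p%:E z ->
  W1_norm Omega p%:E (z - y) = 0 -> J z = J y.
Proof.
move=> hy hz yz0; apply/eqP; rewrite -subr_eq0 -normr_le0; apply/ler_addgt0Pr => e e0.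
have [delta delta0 hd] := hJ hy e0.
by rewrite add0r ltW// hd// yz0.
Qed.

(** [inv_laplacian] selects an arbitrary solution; two solutions differ by a jet of norm zero, which
    [J] cannot see. *)
Lemma weak_solution_eqJ mu y z :
  weak_solution Omega p%:E (pairing mu) y -> weak_solution Omega p%:E (pairing mu) z ->
  J y = J z.
Proof.
move=> hy hz; apply: continuous_W10_eq; [exact: hz.1|exact: hy.1|].
have hmu : Wm1 Omega p%:E (pairing mu) by rewrite /Wm1 pqE; exact: pairing_dual.
by have [_] := hlaplace hmu; apply.
Qed.

(** The direction [h] is a state of [nu] minus that of [mu]. The state of a mixture equals
    [S u + b h] only up to norm zero, hence the first claim is stated after applying [J]. Here [p]
    is the exponent of the states and [y] is the adjoint state. *)
Lemma control_directional (u : {charge set T -> \bar R}) mu nu (y : jet) :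
  (forall A, measurable A -> u A = mu A) -> adjoint_state Omega p%:E J (S u) y ->
  exists h, [/\
    forall (a b : {nonneg R}), a%:num + b%:num = 1 ->
      J (S (charge_of_finite_measure (measure_mix a b mu nu))) = J (S u + b%:num *: h) &
    (fun t : R => t^-1 * (J (S u + t *: h) - J (S u))) @ 0^' --> pairing nu y - pairing mu y].
Proof.
move=> umu [F [dF hF] [Wy hy]].
have hS := control_to_stateP umu.
have [z hz] : exists z, weak_solution Omega p%:E (pairing nu) z.
  by have /hlaplace[] : Wm1 Omega p%:E (pairing nu) by rewrite /Wm1 pqE; exact: pairing_dual.
have pE : hoelder_conjugate q%:E = p%:E by rewrite -pqE hoelder_conjugateK.
have hh := weak_solution_lin mO bO p1 q1 pq (-1) pqE hS hz.
have [Wh hhE] := hh.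
exists (-1 *: S u + z); split=> [a b ab|].
  apply: (@weak_solution_eqJ (measure_mix a b mu nu)); first exact: control_to_stateP.
  rewrite addrC; apply: eq_weak_solution (weak_solution_lin mO bO p1 q1 pq b%:num pqE hh hS).
  move=> v hv /=; have aE : a%:num = 1 - b%:num by rewrite -ab addrK.
  by rewrite pairing_mix// aE; ring.
(* Symmetry of the weak Laplacian: the adjoint equation is tested with the direction, the equation
   of the direction with [y], and both integrals agree. *)
have -> : pairing nu y - pairing mu y = F (-1 *: S u + z).
  rewrite pqE in Wy hy; rewrite -hy ?pE//.
  have := hhE y; rewrite pqE => /(_ Wy) hhy.
  transitivity (-1 * pairing mu y + pairing nu y); [ring|rewrite -hhy].
  by apply: eq_Rintegral => x _; exact: dotC.
exact: hF.
Qed.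

End ControlToState.

(** * Localizing the support by a uniform cost gap *)

Section TransportSupport.
Context {R : realType} {d : nat}.
Local Notation T := 'rV[R]_d.
Variables (omega0 omega1 K : set T) (phi : T * T -> R) (tau : T -> T).
Hypothesis cK : compact K.
Hypothesis cphi : {within K `*` omega1, continuous phi}.
Hypothesis tau_omega1 : forall x, K x -> omega1 (tau x).
Hypothesis tau_min : forall x xi, K x -> omega1 xi -> phi (x, tau x) <= phi (x, xi).

(** Compactness of [K] makes the positive gap at [xi0] uniform. Continuity of [tau] is not at hand:
    for [x'] near [x], [phi (x', tau x')] is bounded above through the fixed competitor [tau x]. *)
Lemma gap_near_nonminimizer xi0 : omega1 xi0 ->
  (forall x, K x -> phi (x, tau x) <> phi (x, xi0)) ->
  exists2 r : R, 0 < r & exists2 delta : R, 0 < delta &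
    forall x xi, K x -> omega1 xi -> eball xi0 r xi ->
      delta <= phi (x, xi) - phi (x, tau x).
Proof.
move=> oxi0 nmin.
have cont x y e : K x -> omega1 y -> 0 < e -> exists2 UV : set T * set T,
    nbhs x UV.1 /\ nbhs y UV.2 & forall x' y', UV.1 x' -> UV.2 y' -> K x' -> omega1 y' ->
      `|phi (x', y') - phi (x, y)| < e.
  move=> Kx oy e0; have /subspace_continuousP/(_ (x, y) (conj Kx oy)) := cphi.
  move=> /cvgrPdist_lt/(_ e e0)[[U V] /= [nU nV] UV]; exists (U, V) => // x' y' Ux Vy Kx' oy'.
  by rewrite distrC; apply: (UV (x', y')).
(* The index is a point near [xi0] paired with a small positive number, so that one neighbourhood
   and one [delta] serve all of [K]. *)
pose P (i : T * R) (x : T) := omega1 i.1 -> K x -> i.2 <= phi (x, i.1) - phi (x, tau x).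
have /compact_near_coveringP/(_ _ (filter_prod (nbhs xi0) 0^'+) P) : compact K by [].
have cover x : K x -> \forall x' \near x & i \near filter_prod (nbhs xi0) 0^'+, P i x'.
  (* A third of the gap: moving [(x, xi0)] and [(x, tau x)] to nearby points costs less than [e]
     each, so more than [e] remains. *)
  move=> Kx; pose e := (phi (x, xi0) - phi (x, tau x)) / 3.
  have e0 : 0 < e.
    rewrite divr_gt0// subr_gt0 lt_neqAle tau_min// andbT.
    by apply/eqP; exact: nmin.
  have [[U V] /= [nU nV] UV] := cont x xi0 e Kx oxi0 e0.
  have [[U' V'] /= [nU' nV'] UV'] := cont x (tau x) e Kx (tau_omega1 Kx) e0.
  exists (U `&` U', V `*` [set s | s < e]) => /=.
    split; first exact: filterI.
    exists (V, [set s | s < e]) => //=; split => //.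
    by apply: nbhs_right_lt.
  move=> [x' [xi s]] /= [[Ux U'x] [Vxi se]] oxi Kx'.
  have := UV _ _ Ux Vxi Kx' oxi; rewrite ltr_norml => /andP[h1 _].
  have := UV' _ _ U'x (nbhs_singleton nV') Kx' (tau_omega1 Kx).
  rewrite ltr_norml => /andP[_ h2].
  have := tau_min Kx' (tau_omega1 Kx); move: h1 h2 se; rewrite /e /=.
  lra.
move=> /(_ _ cover)[[V W] /= [nV nW] VW].
have [delta [Wdelta delta0]] : exists delta, W delta /\ 0 < delta.
  exact: filter_ex (filterI nW (nbhs_right_gt 0)).
have /nbhs_ballP[r /= r0 rV] := nV.
exists r => //; exists delta => // x xi Kx oxi xir.
apply: (VW (xi, delta) _ x) => //=; split => //.
by apply: rV; exact: eball_sub_ball.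
Qed.

Hypotheses (mK : measurable K) (momega1 : measurable omega1).
Variables (u0 : {finite_measure set T -> \bar R}) (u : set T -> \bar R).
Hypothesis u0K : u0 (~` K) = 0%E.
Hypothesis (bphi : bounded_mfun phi) (mtau : measurable_fun setT tau).

(** The excess [psi] is nonnegative on [D] and at least [delta] where the target lies in [B], which
    every plan gives mass [u B]. Neither number depends on the plan, so no plan meets the tolerance
    of half of [delta * fine (u B)]. *)
Lemma supp_sub_minimizers :
  (forall eps, 0 < eps -> exists2 pi, transport_plans omega0 omega1 u0 u pi &
     \int[pi]_z phi z <= \int[u0]_x phi (x, tau x) + eps) ->
  forall xi, supp omega1 u xi -> exists2 x, K x & phi (x, tau x) = phi (x, xi).
Proof.
move=> happrox xi0 [oxi0 uxi0]; apply: contrapT => nex.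
have nmin x : K x -> phi (x, tau x) <> phi (x, xi0) by move=> Kx eqp; apply: nex; exists x.
have [r r0 [delta delta0 gap]] := gap_near_nonminimizer oxi0 nmin.
set B := eball xi0 r in gap; have mB : measurable B by exact: eball_measurable.
have uB : (0 < u B)%E by exact: uxi0.
(* Any plan shows that [u B] is finite; [u] is an arbitrary set function here. *)
have [pi0 [_ _ pi0u] _] := happrox 1 ltr01.
have uBfin : u B \is a fin_num.
  by rewrite -pi0u//; apply: fin_num_measure; rewrite -[X in measurable X]setTI; exact: measurable_snd.
have fB : 0 < fine (u B) by rewrite fine_gt0// uB ltey_eq uBfin.
have dB : 0 < delta * fine (u B) by rewrite mulr_gt0.
have [pi [pic pi0E pi1E] hpi] := happrox _ (divr_gt0 dB (ltr0Sn R 1)).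
pose D := K `*` omega1; have mD : measurable D by exact: measurableX.
have mtau1 : measurable_fun setT (fun x => (x, tau x)) by exact: measurable_fun_pair.
have bm : bounded_mfun (fun x => phi (x, tau x)) := bounded_mfun_comp mtau1 bphi.
have bm1 : bounded_mfun (fun z : T * T => phi (z.1, tau z.1)) :=
  bounded_mfun_comp measurable_fst bm.
pose psi z := phi z - phi (z.1, tau z.1).
have bpsi : bounded_mfun psi.
  have := bounded_mfunD bphi (bounded_mfunZ (-1) bm1); congr bounded_mfun.
  by apply/funext => z; rewrite mulN1r.
have int_psi : \int[pi]_z psi z <= delta * fine (u B) / 2.
  rewrite RintegralB//; try exact: bounded_mfun_integrable.
  rewrite lerBlDl (le_trans hpi)// lerD2r.
  rewrite -(Rintegral_finite_pushforward pi measurable_fst bm) le_eqVlt.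
  apply/orP; left; apply/eqP/eq_finite_measure_Rintegral => A mA.
  by apply/esym; exact: pi0E.
(* Off [D] either the first coordinate leaves [K], which [u0] does not charge beyond, or the pair
   leaves the product that carries the plan. *)
have piD : pi (~` D) = 0%E.
  have mF : measurable (fst @^-1` (~` K) : set (T * T)).
    by rewrite -[X in measurable X]setTI; apply: measurable_fst => //; exact: measurableC.
  have nF : pi.-negligible (fst @^-1` (~` K)).
    apply/negligibleP => //; rewrite -u0K.
    by apply: pi0E; exact: measurableC.
  have mN : measurable (~` D `\` fst @^-1` (~` K)).
    by apply: measurableD => //; exact: measurableC.
  have nN : pi.-negligible (~` D `\` fst @^-1` (~` K)).
    apply/negligibleP => //; apply: pic => //; apply/seteqP; split=> // -[x y] /=.
    by move=> [[nD /contrapT Kx] [ox oy]]; apply: nD.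
  apply: measure_negligible; first exact: measurableC.
  apply: negligibleS (negligibleU nF nN) => z nDz.
  by have [nK|Kz] := pselect ((fst @^-1` (~` K)) z); [left|right].
have mS : measurable (snd @^-1` B : set (T * T)).
  by rewrite -[X in measurable X]setTI; exact: measurable_snd.
have bind : bounded_mfun (\1_(snd @^-1` B) : T * T -> R).
  split; first exact: measurable_indic.
  by exists 1 => z; rewrite indicE; case: (_ \in _); rewrite ?normr1 ?normr0.
have ipsi := bounded_mfun_integrable pi bpsi.
have int_gap : delta * fine (u B) <= \int[pi]_z psi z.
  rewrite -(pi1E _ mB) /pushforward.
  have -> : \int[pi]_z psi z = \int[pi]_(z in D) psi z.
    rewrite /Rintegral (negligible_integral (N := ~` D))//; last exact: measurableC.
    by rewrite setTD setCK.
  have -> : delta * fine (pi (snd @^-1` B)) = \int[pi]_(z in D) (delta * \1_(snd @^-1` B) z).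
    rewrite RintegralZl//; last first.
      by apply: (@integrableS _ _ _ _ setT) => //; exact: (bounded_mfun_integrable pi bind).
    congr (_ * _); rewrite /Rintegral integral_indic//; congr fine.
    rewrite -[in LHS](setIT (snd @^-1` B)) -(setUv D) setIUr measureU//; first last.
    - by rewrite setIACA setICr setI0.
    - by apply: measurableI => //; exact: measurableC.
    - exact: measurableI.
    rewrite [X in (_ + X)%E](_ : _ = 0%E) ?adde0//.
    apply: measure_negligible; first by apply: measurableI => //; exact: measurableC.
    apply: (@negligibleS _ _ _ _ (~` D)) => [z []//|].
    by apply/negligibleP => //; exact: measurableC.
  apply: le_Rintegral => //.
  - apply: (@integrableS _ _ _ _ setT) => //.
    exact: (bounded_mfun_integrable pi (bounded_mfunZ delta bind)).
  - by apply: (@integrableS _ _ _ _ setT).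
  move=> [x xi] [/= Kx oxi]; rewrite indicE.
  have [/set_mem /= Bxi|_] := boolP ((x, xi) \in snd @^-1` B).
    by rewrite mulr1; exact: gap.
  rewrite mulr0.
  by rewrite /psi /= subr_ge0 tau_min.
by move: (le_trans int_gap int_psi); rewrite leNgt ltr_pdivrMr// ltr_pMr// ltr1n.
Qed.

End TransportSupport.

(** * Transport plans and their cost *)

Section TransportPlans.
Context {R : realType} {d : nat}.
Local Notation T := 'rV[R]_d.
Variables (omega0 omega1 : set T) (c : T * T -> R).
Hypotheses (comega0 : compact omega0) (comega1 : compact omega1).
Hypothesis hc : {within omega0 `*` omega1, continuous c}.
Variable u0 : {finite_measure set T -> \bar R}.

Local Notation ctilde := (c \_ (omega0 `*` omega1)).
Local Notation plans := (transport_plans omega0 omega1 u0).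
Local Notation tcost := (transport_cost omega0 omega1 c u0).

Lemma cost_bounded_mfun : bounded_mfun ctilde.
Proof. exact: within_continuous_prod_bounded_mfun. Qed.

Lemma cost_Rintegral (pi : {finite_measure set (T * T)%type -> \bar R}) :
  (\int[pi]_(z in omega0 `*` omega1) (c z)%:E = (\int[pi]_z ctilde z)%:E)%E.
Proof.
rewrite integral_mkcond /Rintegral fineK.
  by apply: eq_integral => z _; rewrite /patch; case: ifP.
apply: integrable_fin_num => //.
exact: (bounded_mfun_integrable pi cost_bounded_mfun).
Qed.

Lemma transport_cost_le u pi : plans u pi -> (tcost u <= (\int[pi]_z ctilde z)%:E)%E.
Proof. by move=> hpi; rewrite -cost_Rintegral; apply: ereal_inf_lbound; exists pi. Qed.

(** All plans share the total mass of [u0] and the integrand is bounded, so the infimum is not [-oo]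
    and can be approached within [eps]. *)
Lemma transport_cost_fin u : (tcost u < +oo)%E -> exists2 D : R, tcost u = D%:E &
  forall eps, 0 < eps -> exists2 pi, plans u pi & \int[pi]_z ctilde z <= D + eps.
Proof.
move=> uoo; have [_ [M cM]] := cost_bounded_mfun.
have lb : ((- (M * fine (u0 setT)))%:E <= tcost u)%E.
  apply: le_ereal_inf_tmp => _ [pi [_ pi0 _] <-]; rewrite cost_Rintegral lee_fin.
  have -> : fine (u0 setT) = fine (pi setT) by rewrite -(pi0 _ measurableT).
  rewrite -mulNr -(Rintegral_cst _ measurableT); apply: le_Rintegral => //.
  - exact: finite_measure_integrable_cst.
  - exact: (bounded_mfun_integrable pi cost_bounded_mfun).
  by move=> z _; have := cM z; rewrite ler_norml => /andP[].
have ufin : tcost u \is a fin_num.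
  by rewrite fin_numElt uoo (lt_le_trans _ lb)// ltNyr.
exists (fine (tcost u)) => [|eps eps0]; first by rewrite fineK.
have [_ [pi hpi <-] hlt] := lb_ereal_inf_adherent eps0 ufin.
exists pi => //; rewrite -lee_fin -cost_Rintegral EFinD fineK//.
exact: ltW.
Qed.

(** Plans mix together with their second marginals, and the cost is linear in the plan: this is the
    source of convexity of the transport cost. [w] is a separate set function because it is later a
    charge. *)
Lemma transport_plans_mix (a b : {nonneg R}) (u v w : set T -> \bar R) pi rho :
  a%:num + b%:num = 1 -> plans u pi -> plans v rho ->
  (forall A, measurable A -> w A = (a%:num%:E * u A + b%:num%:E * v A)%E) ->
  plans w (measure_mix a b pi rho).
Proof.
move=> ab [pic pi0 pi1] [rhoc rho0 rho1] wE; split=> A mA.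
- by move=> A0; rewrite /= measure_mixE pic// rhoc// !mule0 adde0.
- have := rho0 A mA; have := pi0 A mA; rewrite /pushforward /= measure_mixE => -> ->.
  by rewrite -ge0_muleDl// -EFinD ab mul1e.
- have := rho1 A mA; have := pi1 A mA; rewrite /pushforward /= measure_mixE => -> ->.
  by rewrite wE.
Qed.

Lemma transport_plans_graph (tau : T -> T) (mtau : measurable_fun setT tau)
    (mgraph : measurable_fun setT (fun x => (x, tau x))) :
  carried_by omega0 u0 -> (forall x, omega1 (tau x)) ->
  plans (finite_pushforward u0 mtau) (finite_pushforward u0 mgraph).
Proof.
move=> u0c tau1; split=> A mA //.
move=> A0; apply: u0c; first by rewrite -[X in measurable X]setTI; exact: mgraph.
apply/seteqP; split=> // x [Ax ox].
have : (A `&` (omega0 `*` omega1)) (x, tau x).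
  exact: (conj Ax (conj ox (tau1 x))).
by rewrite A0.
Qed.

End TransportPlans.

(** * First-order optimality condition *)

Section FirstOrder.
Context {R : realType} {d : nat}.
Local Notation T := 'rV[R]_d.
Local Notation jet := (jet R d).
Variables (Omega omega0 omega1 : set T).
Hypotheses (mO : measurable Omega) (bO : bounded_set Omega).
Hypotheses (comega0 : compact omega0) (comega1 : compact omega1).
Hypothesis omega1O : omega1 `<=` closure Omega.
Variables (p q : R).
Hypotheses (p1 : 1 <= p) (q1 : 1 <= q) (pq : p^-1 + q^-1 = 1).
Hypothesis pqE : hoelder_conjugate p%:E = q%:E.
Variables (E : jet -> T -> R) (hE : sobolev_embedding Omega q%:E E).
Hypothesis hlaplace : laplace_isomorphism Omega p%:E.
Variables (J : jet -> R) (hJ : continuous_W10 Omega p%:E J).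
Variables (u0 : {finite_measure set T -> \bar R}) (hu0 : carried_by omega0 u0).
Variables (c : T * T -> R) (hc : {within omega0 `*` omega1, continuous c}).
Variables (alpha : R) (alpha0 : 0 < alpha).
Local Notation S := (control_to_state Omega p%:E omega1 E).
Local Notation ctilde := (c \_ (omega0 `*` omega1)).
Variable ubar : {charge set T -> \bar R}.
Hypothesis hubar : locally_optimal omega1 (objective omega0 omega1 u0 c alpha J S) ubar.
Variables (y : jet) (hy : adjoint_state Omega p%:E J (S ubar) y).

Let momega1 : measurable omega1. Proof. exact: compact_rV_measurable. Qed.

(** The comparison plan is the graph plan of [tau]. Since [D] is only an infimum of costs, the slack
    [eps] is spent on a plan of cost at most [D + eps / alpha]. *)
Lemma first_order_condition (tau : T -> T) : measurable_fun setT tau ->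
  (forall x, omega1 (tau x)) -> forall eps, 0 < eps ->
  exists2 pi, transport_plans omega0 omega1 u0 ubar pi &
    \int[pi]_z (alpha * ctilde z + (E y \_ omega1) z.2) <=
    \int[u0]_x (alpha * ctilde (x, tau x) + (E y \_ omega1) (tau x)) + eps.
Proof.
move=> mtau tau1 eps eps0; have [cu fu [delta delta0 opt]] := hubar.
have bc := cost_bounded_mfun comega0 comega1 hc.
have uoo : (transport_cost omega0 omega1 c u0 ubar < +oo)%E.
  rewrite ltey; apply/eqP => uoo; move: fu.
  by rewrite /objective uoo gt0_muley ?lte_fin// addey.
have [D DE happrox] := transport_cost_fin comega0 comega1 hc uoo.
(* Any plan shows that [ubar], a priori a charge, is a measure: its second marginal [mu]. *)
have [pi0 [pi0c _ pi01] _] := happrox 1 ltr01.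
pose mu : {finite_measure set T -> \bar R} := finite_pushforward pi0 measurable_snd.
have umu A : measurable A -> ubar A = mu A by move=> mA; rewrite -pi01.
pose nu : {finite_measure set T -> \bar R} := finite_pushforward u0 mtau.
have mgraph : measurable_fun setT (fun x => (x, tau x)) by exact: measurable_fun_pair.
pose rho : {finite_measure set (T * T)%type -> \bar R} := finite_pushforward u0 mgraph.
have hrho : transport_plans omega0 omega1 u0 nu rho by exact: transport_plans_graph.
have [h [hJt hlim]] := control_directional mO bO comega1 omega1O p1 q1 pq pqE hE hlaplace hJ nu umu hy.
set L := pairing _ _ nu y - _ in hlim.
set Ctau := \int[rho]_z ctilde z.
have fmu A : measurable A -> mu A = (fine (mu A))%:E.
  by move=> mA; rewrite fineK// fin_num_measure.
have fnu A : measurable A -> nu A = (fine (nu A))%:E.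
  by move=> mA; rewrite fineK// fin_num_measure.
set M := fine (mu setT) + fine (nu setT).
have M0 : 0 <= M by rewrite addr_ge0// fine_ge0.
(* [ut - ubar] is [t * (nu - mu)], at most [t * M] on each set; [tv_norm_le] doubles this bound. *)
have descent (t : R) : 0 < t -> t <= 1 -> t * M + t * M < delta ->
    t * (alpha * (D - Ctau)) <= J (S ubar + t *: h) - J (S ubar).
  move=> t0 t1 tdelta.
  have s0 : 0 <= 1 - t by rewrite subr_ge0.
  pose a := NngNum s0; pose b := NngNum (ltW t0).
  have ab : a%:num + b%:num = 1 by rewrite /= subrK.
  pose ut := charge_of_finite_measure (measure_mix a b mu nu).
  have utE A : measurable A -> ut A = ((1 - t) * fine (mu A) + t * fine (nu A))%:E.
    by move=> mA; rewrite /ut /= /charge_of_finite_measure measure_mixE fmu// fnu.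
  have carried_ut : carried_by omega1 ut.
    move=> A mA A0; rewrite utE// -(umu _ mA) cu//.
    have -> : nu A = 0%E.
      rewrite /nu /= /finite_pushforward /pushforward (_ : _ @^-1` _ = set0) ?measure0//.
      apply/seteqP; split=> // x Ax.
      by have : (A `&` omega1) (tau x) := conj Ax (tau1 x); rewrite A0.
    by rewrite !mulr0 addr0.
  have /(opt _ carried_ut) : (tv_norm (cadd ut (cscale (-1) ubar)) < delta%:E)%E.
    apply: le_lt_trans (_ : _ <= (t * M + t * M)%:E)%E _; last by rewrite lte_fin.
    apply: tv_norm_le => A mA.
    rewrite [X in (`|X| <= _)%E](_ : _ = (t * (fine (nu A) - fine (mu A)))%:E); last first.
      transitivity (ut A + (-1)%:E * ubar A)%E => //.
      by rewrite utE// umu// [mu A]fmu// -EFinM -EFinD; congr EFin; rewrite /=; ring.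
    rewrite lee_fin normrM gtr0_norm// ler_pM2l// (le_trans (ler_normB _ _))//.
    rewrite !ger0_norm ?fine_ge0// addrC lerD// fine_le ?fin_num_measure//;
      by apply: le_measure; rewrite ?inE.
  have Jt : J (S ut) = J (S ubar + t *: h) := hJt a b ab.
  rewrite /objective DE Jt => hopt.
  have cost_ut pi : transport_plans omega0 omega1 u0 ubar pi ->
      (transport_cost omega0 omega1 c u0 ut <=
       ((1 - t) * \int[pi]_z ctilde z + t * Ctau)%:E)%E.
    move=> hpi; have utE' A : measurable A ->
        ut A = (a%:num%:E * ubar A + b%:num%:E * nu A)%E.
      by move=> mA; rewrite umu// -measure_mixE.
    have := transport_cost_le comega0 comega1 hc (transport_plans_mix ab hpi hrho utE').
    by rewrite Rintegral_mix.
  have Dle : J (S ubar) + alpha * D <=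
      J (S ubar + t *: h) + alpha * ((1 - t) * D + t * Ctau).
    apply/ler_addgt0Pr => e e0.
    have [pi hpi piD] := happrox (e / alpha) (divr_gt0 e0 alpha0).
    rewrite -lee_fin EFinD EFinM; apply: (le_trans hopt).
    apply: (@le_trans _ _ (J (S ubar + t *: h) +
      alpha * ((1 - t) * \int[pi]_z ctilde z + t * Ctau))%:E).
      rewrite EFinD leeD2l// EFinM lee_pmul2l ?lte_fin//.
      exact: cost_ut.
    rewrite lee_fin -addrA lerD2l.
    have -> : alpha * ((1 - t) * D + t * Ctau) + e =
      alpha * ((1 - t) * D + t * Ctau + e / alpha) by field; rewrite gt_eqF.
    rewrite ler_pM2l// [leRHS]addrAC lerD2r.
    apply: (@le_trans _ _ ((1 - t) * (D + e / alpha))); first exact: ler_wpM2l.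
    rewrite mulrDr lerD2l ler_piMl//; last by rewrite gerBl ltW.
    by rewrite divr_ge0 ?ltW.
  by move: Dle; lra.
(* Otherwise the difference quotients of [J] fall below [alpha * (D - Ctau)] near zero, while
   [descent] keeps them above it. *)
have key : alpha * (D - Ctau) <= L.
  rewrite leNgt; apply/negP => Llt.
  have : nbhs (0 : R) [set t : R | t != 0 ->
      t^-1 * (J (S ubar + t *: h) - J (S ubar)) < alpha * (D - Ctau)].
    exact: (cvgr_lt _ hlim _ Llt).
  move=> /nbhs_ballP[e /= e0 he].
  (* [e / 2] enters the ball, [1] keeps a convex combination, and the last term ensures
     [2 * t * M < delta]; the [1] added to [M] covers [M = 0]. *)
  pose t := Num.min (e / 2) (Num.min 1 (delta / (4 * (M + 1)))).
  have M1 : 0 < M + 1 by rewrite ltr_wpDl.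
  have t0 : 0 < t by rewrite !lt_min ltr01 !divr_gt0// mulr_gt0.
  have t1 : t <= 1 by rewrite !ge_min lexx orbT.
  have te : t < e by rewrite !gt_min ltr_pdivrMr// ltr_pMr// ltr1n.
  have tM : t * (4 * (M + 1)) <= delta.
    by rewrite -ler_pdivlMr ?mulr_gt0// !ge_min lexx !orbT.
  have tdelta : t * M + t * M < delta.
    apply: lt_le_trans tM; rewrite -mulrDr ltr_pM2l//; lra.
  have := he t; rewrite /ball /= sub0r normrN gtr0_norm// => /(_ te).
  rewrite gt_eqF// => /(_ isT).
  by rewrite ltNge ler_pdivlMl// descent.
have [pi hpi piD] := happrox (eps / alpha) (divr_gt0 eps0 alpha0).
exists pi => //.
have Wy : W10 Omega q%:E y by have [F _ [+ _]] := hy; rewrite pqE.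
have bg : bounded_mfun (E y \_ omega1) by exact: (embedding_bounded_mfun comega1 omega1O hE).
have -> : \int[pi]_z (alpha * ctilde z + (E y \_ omega1) z.2) =
    alpha * \int[pi]_z ctilde z + pairing omega1 E mu y.
  rewrite Rintegral_bmD; [|exact: bounded_mfunZ|exact: (bounded_mfun_comp measurable_snd bg)].
  rewrite Rintegral_bmZ//; congr (_ + _).
  rewrite -(Rintegral_finite_pushforward pi measurable_snd bg).
  apply: eq_finite_measure_Rintegral => A mA; rewrite -umu//.
  by have [_ _ pi1] := hpi; exact: pi1.
have -> : \int[u0]_x (alpha * ctilde (x, tau x) + (E y \_ omega1) (tau x)) =
    alpha * Ctau + pairing omega1 E nu y.
  have bcg : bounded_mfun (fun x => ctilde (x, tau x)) := bounded_mfun_comp mgraph bc.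
  rewrite Rintegral_bmD; [|exact: bounded_mfunZ|exact: (bounded_mfun_comp mtau bg)].
  rewrite Rintegral_bmZ//; congr (_ * _ + _).
    by rewrite /Ctau /rho Rintegral_finite_pushforward.
  by rewrite /pairing /nu Rintegral_finite_pushforward.
have : alpha * \int[pi]_z ctilde z <= alpha * D + eps.
  apply: (@le_trans _ _ (alpha * (D + eps / alpha))); first by rewrite ler_pM2l.
  by rewrite mulrDr mulrCA divff ?mulr1// gt_eqF.
by move: key; rewrite /L; lra.
Qed.

End FirstOrder.

(** * Borel choice of minimizers and the comparison of supports *)

Lemma measurable_fun_countable_patch (R : realType) (d : nat) (K : set 'rV[R]_d)
    (f : 'rV[R]_d -> 'rV[R]_d) (a : 'rV[R]_d) : countable K ->
  measurable_fun setT (patch (fun=> a) K f).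
Proof.
move=> cK _ Y mY; rewrite setTI.
(* Every subset of a countable set is Borel, so a preimage is a countable set, joined with the
   complement of [K] when [a] lies in [Y]. *)
have mcount A : A `<=` K -> measurable A.
  move=> AK; apply: countable_measurable; last exact: sub_countable (subset_card_le AK) cK.
  by move=> x; apply: closed_rV_measurable; apply: compact_closed => //; exact: compact_set1.
have -> : patch (fun=> a) K f @^-1` Y =
    (K `&` f @^-1` Y) `|` (~` K `&` [set x | Y a]).
  apply/seteqP; split => x /=; rewrite /patch.
    by case: ifPn => [/set_mem Kx|/negP nKx]; [left|right; split=> // /mem_set].
  by move=> [[Kx fx]|[nKx ax]]; [rewrite mem_set|rewrite memNset].
apply: measurableU; first exact: mcount.
have [Ya|nYa] := pselect (Y a).
  rewrite (_ : [set x | Y a] = setT); last by apply/seteqP; split.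
  by rewrite setIT; apply: measurableC; exact: mcount.
rewrite (_ : [set x | Y a] = set0); last by apply/seteqP; split.
by rewrite setI0.
Qed.

Lemma within_continuous_cost (R : realType) (d : nat) (omega0 omega1 K : set 'rV[R]_d)
    (c : 'rV[R]_d * 'rV[R]_d -> R) (g : 'rV[R]_d -> R) (alpha : R) :
  K `<=` omega0 -> {within omega0 `*` omega1, continuous c} ->
  {within omega1, continuous g} ->
  {within K `*` omega1, continuous (fun z => alpha * (c \_ (omega0 `*` omega1)) z +
     (g \_ omega1) z.2)}.
Proof.
move=> Ko cc cg.
apply: (@subspace_eq_continuous _ _ _ (fun z => alpha * c z + g z.2)).
  move=> z /set_mem[Kz oz]; rewrite /from_subspace /patch !mem_set//.
  by split => //; exact: Ko.
move: cc cg => /subspace_continuousP cc /subspace_continuousP cg.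
apply/subspace_continuousP => -[x xi] [/= Kx oxi].
apply: cvgD.
  apply: cvgMl_tmp; apply: cvg_trans (cc (x, xi) (conj (Ko _ Kx) oxi)).
  by apply: cvg_fmap2; apply: within_subset => -[a b] [/Ko].
apply/cvgrPdist_lt => e e0; have /cvgrPdist_lt/(_ e e0) := cg xi oxi.
rewrite !near_withinE => V; exists (setT, [set b | omega1 b -> `|g xi - g b| < e]) => /=.
  by split; [exact: filterT|exact: V].
by move=> [a b] [_ /=] h [_ /h].
Qed.

Lemma within_continuous_slice (R : realType) (T1 T2 : topologicalType) (K : set T1)
    (L : set T2) (f : T1 * T2 -> R) x : {within K `*` L, continuous f} -> K x ->
  {within L, continuous (fun y => f (x, y))}.
Proof.
move=> /subspace_continuousP cf Kx; apply/subspace_continuousP => y Ly.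
apply/cvgrPdist_lt => e e0; have /cvgrPdist_lt/(_ e e0) := cf (x, y) (conj Kx Ly).
move=> [[U V] /= [nU nV] UV]; rewrite near_withinE.
apply: filterS nV => b Vb Lb; apply: (UV (x, b)) => //=.
by split => //; exact: nbhs_singleton.
Qed.

Theorem corollary6p6 (R : realType) (d : nat) (hd : d = 2%N \/ d = 3%N)
    (Omega omega0 omega1 : set 'rV[R]_d)
    (hOmega : lipschitz_domain Omega)
    (homega0 : compact omega0 /\ omega0 !=set0)
    (homega1 : [/\ compact omega1, omega1 !=set0 & omega1 `<=` closure Omega])
    (u0 : {finite_measure set 'rV[R]_d -> \bar R})
    (hu0 : carried_by omega0 u0)
    (c : 'rV[R]_d * 'rV[R]_d -> R)
    (hc : {within omega0 `*` omega1, continuous c})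
    (alpha : R) (halpha : 0 < alpha)
    (pOmega : \bar R)
    (hpOmega : (d%:R%:E < pOmega)%E)
    (hlaplace : forall p : \bar R,
       (hoelder_conjugate pOmega < p < pOmega)%E -> laplace_isomorphism Omega p)
    (q : \bar R)
    (hq : (d%:R%:E < hoelder_conjugate q < pOmega)%E)
    (hq3 : d = 3%N -> (hoelder_conjugate q < 6%:E)%E)
    (J : jet R d -> R)
    (hJcont : continuous_W10 Omega q J)
    (hJdiff : forall y, W10 Omega q y ->
       exists F, gateaux_derivative Omega q J y F)
    (E : jet R d -> 'rV[R]_d -> R)
    (hE : sobolev_embedding Omega (hoelder_conjugate q) E)
    (hconvex : convex_set omega1)
    (h : 'rV[R]_d -> R)
    (hch : forall x xi, omega0 x -> omega1 xi -> c (x, xi) = h (xi - x))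
    (hh : convex_function [set: 'rV[R]_d] h)
    (betaR : R -> R)
    (hbetaR : forall r, 0 < r -> 0 < betaR r /\
       forall x xs xi xis, subdifferential h x xs -> subdifferential h xi xis ->
         eball 0 r x -> eball 0 r xi ->
         betaR r * enorm (x - xi) ^+ 2 <= dot (xs - xis) (x - xi))
    (rho : R) (hrho : 0 < rho)
    (hrhoball : forall x xi, omega0 x -> omega1 xi -> eball 0 rho (xi - x))
    (ubar : {charge set 'rV[R]_d -> \bar R})
    (hubar : locally_optimal omega1
       (objective omega0 omega1 u0 c alpha J
          (control_to_state Omega q omega1 E)) ubar)
    (p : jet R d)
    (hp : adjoint_state Omega q J (control_to_state Omega q omega1 E ubar) p)
    (U : set 'rV[R]_d) (g : 'rV[R]_d -> R)
    (hU : omega1 `<=` U) (hg : C1_on U g)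
    (hgp : forall xi, omega1 xi -> g xi = E p xi)
    (kappa : R) (hkappa : kappa < alpha * betaR rho)
    (hmono : forall xi zeta, omega1 xi -> omega1 zeta ->
       - kappa * enorm (xi - zeta) ^+ 2 <=
       dot (grad g xi - grad g zeta) (xi - zeta)) :
  (countable (supp omega0 u0) -> countable (supp omega1 ubar)) /\
  (forall m : nat, (supp omega0 u0 #= `I_m)%card ->
     (supp omega1 ubar #<= `I_m)%card).
Proof.
have d2 : (2 <= d)%N by case: hd => ->.
have [[a [b [qE qE' a1 b1 ab]]] hq_lap] := conjugate_exponents d2 hq.
have lap := hlaplace _ hq_lap.
rewrite qE' in hE; rewrite qE in lap hJcont hubar hp.
have pqE : hoelder_conjugate a%:E = b%:E by rewrite -qE.
have [oO bO _ _] := hOmega; have mO := open_rV_measurable oO.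
have [comega0 omega00] := homega0; have [comega1 [xi1 oxi1] omega1O] := homega1.
have Wp : W10 Omega b%:E p by have [F _ [+ _]] := hp; rewrite pqE.
have cEp := embedding_within_continuous omega1O hE Wp.
set K := supp omega0 u0.
have Komega0 : K `<=` omega0 by move=> x [].
have clK : closed K by apply: supp_closed; exact: compact_closed.
have cK : compact K := subclosed_compact clK comega0 Komega0.
have mK : measurable K by exact: compact_rV_measurable.
have u0K : u0 (~` K) = 0%E.
  apply: measure_negligible; first exact: measurableC.
  by apply: supp_conegligible => //; exact: compact_rV_measurable.
(* Both terms are extended by zero to be bounded and Borel on the whole space; [phiE] recovers the
   intended function on [omega0] times [omega1]. *)
pose phi z := alpha * (c \_ (omega0 `*` omega1)) z + (E p \_ omega1) z.2.
have cphi : {within K `*` omega1, continuous phi} by exact: within_continuous_cost.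
have phiE x xi : omega0 x -> omega1 xi -> phi (x, xi) = g xi + alpha * h (xi - x).
  by move=> ox oxi; rewrite /phi /patch !mem_set// hch// hgp// addrC.
have bphi : bounded_mfun phi.
  apply: bounded_mfunD; first by apply: bounded_mfunZ; exact: cost_bounded_mfun.
  exact: (bounded_mfun_comp measurable_snd (embedding_bounded_mfun _ omega1O hE Wp)).
have [tau0 htau0] : {tau0 : 'rV[R]_d -> 'rV[R]_d & forall x, K x ->
    omega1 (tau0 x) /\ forall xi, omega1 xi -> phi (x, tau0 x) <= phi (x, xi)}.
  apply: (choice (P := fun x y => K x -> omega1 y /\ forall xi, omega1 xi -> phi (x, y) <= phi (x, xi))) => x.
  have [Kx|nKx] := pselect (K x); last by exists 0.
  have cphix : {within omega1, continuous (fun xi => phi (x, xi))}.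
    exact: within_continuous_slice cphi Kx.
  have [y /set_mem oy ymin] := compact_EVT_min (ex_intro _ _ oxi1) comega1 cphix.
  by exists y => _; split=> // xi oxi; apply: ymin; rewrite inE.
have countable_case : countable K -> exists tau, supp omega1 ubar `<=` tau @` K.
  (* Off [K] the value is a fixed point of [omega1], since the graph plan requires [tau] to map the
     whole space into [omega1]. *)
  move=> countK; pose tau := patch (fun=> xi1) K tau0.
  have mtau : measurable_fun setT tau by exact: measurable_fun_countable_patch.
  have tauE x : K x -> tau x = tau0 x by move=> Kx; rewrite /tau /patch mem_set.
  have tau1 x : omega1 (tau x).
    by rewrite /tau /patch; case: ifPn => // /set_mem /htau0[].
  have taumin x xi : K x -> omega1 xi -> phi (x, tau x) <= phi (x, xi).
    by move=> Kx oxi; rewrite tauE//; have [_] := htau0 _ Kx; apply.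
  exists tau => xi hxi.
  have happrox := first_order_condition mO bO comega0 comega1 omega1O a1 b1 ab pqE hE lap
    hJcont hu0 hc halpha hubar hp mtau tau1.
  have [x Kx xE] := supp_sub_minimizers cK cphi (fun x _ => tau1 x) taumin mK
    (compact_rV_measurable comega1) u0K bphi mtau happrox hxi.
  have [oxi _] := hxi; have ox := Komega0 _ Kx.
  exists x => //.
  (* The modulus for radius [rho] applies because [omega1 - x] lies in that ball for [x] in
     [omega0]. *)
  have [_ hbeta] := hbetaR _ hrho.
  apply: (strongly_convex_argmin_unique (g := g) (x := x) halpha hkappa hh hconvex) => //.
  - by move=> y oy; have [_ /(_ _ (hU _ oy))[]] := hg.
  - move=> y ys z zs oy oz hys hzs; apply: hbeta => //.
      by have := hrhoball _ _ ox oy; rewrite addrK.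
    by have := hrhoball _ _ ox oz; rewrite addrK.
  - by move=> w ow; rewrite -!phiE// ; exact: taumin.
  - by move=> w ow; rewrite -!phiE// -xE; exact: taumin.
(* Comparing cardinalities settles the countable and the finite claim together. *)
have card_case : countable K -> (supp omega1 ubar #<= K)%card.
  move=> /countable_case[tau /subset_card_le/card_le_trans]; apply.
  exact: card_image_le.
split=> [countK|m Km]; first exact: sub_countable (card_case countK) countK.
have [Kle _] : (K #<= `I_m)%card /\ (`I_m #<= K)%card.
  by apply/andP; rewrite -card_eq_le.
apply: card_le_trans Kle; apply: card_case; apply: finite_set_countable.
by apply/finite_setP; exists m.
Qed.
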